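(* Let $A_\Gamma$ be a large-type Artin group with $\Gamma$ connected, and let $A\le\mathrm{Aut}(A_\Gamma)$ be a subgroup that has a compatible action on the Deligne complex $X_\Gamma$. Then $A\le\mathrm{Aut}_\Gamma(A_\Gamma)$.
   Context: Let $\Gamma$ be a finite simplicial graph with each edge $\{a,b\}$ labelled by an integer $m_{ab}\ge 2$; put $m_{ab}=\infty$ if $a\neq b$ are not adjacent. $A_\Gamma=\langle V(\Gamma)\mid \underbrace{aba\cdots}_{m_{ab}}=\underbrace{bab\cdots}_{m_{ab}}\ \text{for all edges }\{a,b\}\rangle$ is large-type if $m_{ab}\ge 3$ for all distinct $a,b$. $\mathrm{Aut}_\Gamma(A_\Gamma)\le\mathrm{Aut}(A_\Gamma)$ is the subgroup generated by all inner automorphisms $\varphi_g:h\mapsto ghg^{-1}$, all graph automorphisms (induced by label-preserving automorphisms of $\Gamma$), and the global inversion $\iota:a\mapsto a^{-1}$ for all $a\in V(\Gamma)$. Deligne complex (large-type case): for $S=\emptyset$, $S=\{s\}$ with $s\in V(\Gamma)$, or $S=\{s,t\}$ an edge of $\Gamma$, let $A_S=\langle S\rangle\le A_\Gamma$. The vertices of the simplicial complex $X_\Gamma$ are the left cosets $gA_S$ ($g\in A_\Gamma$), and chains of strict inclusions of such cosets span simplices. $A_\Gamma$ acts by left multiplication. $X_\Gamma$ carries the Moussong metric: the triangle on $gA_\emptyset,gA_{\{a\}},gA_{\{a,b\}}$ is the Euclidean triangle with angle $\pi/(2m_{ab})$ at $gA_{\{a,b\}}$, angle $\pi/2$ at $gA_{\{a\}}$,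 and edge of length $1$ between $gA_\emptyset$ and $gA_{\{a\}}$ (each edge between $gA_\emptyset$ and $gA_{\{a\}}$ has length $1$); $X_\Gamma$ has the induced length metric. Compatible action: if a group $G$ acts by isometries on a metric space $X$ via $\Omega:G\to\mathrm{Isom}(X)$, a subgroup $A$ with $\mathrm{Inn}(G)\le A\le\mathrm{Aut}(G)$ has a compatible action on $X$ if there is a homomorphism $\Psi:A\to\mathrm{Isom}(X)$ with $\Psi(\varphi_g)=\Omega(g)$ for all $g\in G$, where $\varphi_g(h)=ghg^{-1}$. *)

(* Defs.v *)
From HB Require Import structures.
From mathcomp Require Import all_boot all_order perm all_algebra.
From mathcomp Require Import all_classical all_reals all_analysis.
Set Implicit Arguments.
Unset Strict Implicit.
Unset Printing Implicit Defensive.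
Import Order.TTheory GRing.Theory Num.Theory.
Local Open Scope classical_set_scope.
Local Open Scope ring_scope.
Local Open Scope quotient_scope.

(* The group presented by the generators [V] and the relators [u = v] for     *)
(* [rels u v].  The letter [(a, false)] stands for [a] and [(a, true)] for    *)
(* [a^-1].                                                                    *)
Section Presentation.
Variables (V : choiceType).
Local Notation word := (seq (V * bool)).
Variable rels : word -> word -> Prop.

Definition inv_letter (l : V * bool) := (l.1, ~~ l.2).
Definition inv_word (w : word) : word := rev (map inv_letter w).

Inductive pres_eq : word -> word -> Prop :=
| pres_refl u : pres_eq u u
| pres_sym u v : pres_eq u v -> pres_eq v u
| pres_trans u v w : pres_eq u v -> pres_eq v w -> pres_eq u w
| pres_free x l y : pres_eq (x ++ [:: l; inv_letter l] ++ y) (x ++ y)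
| pres_rel x u v y : rels u v -> pres_eq (x ++ u ++ y) (x ++ v ++ y).

Definition pres_eqb (u v : word) : bool := `[< pres_eq u v >].

Lemma pres_eqb_equiv : equiv_class_of pres_eqb.
Proof.
split=> [u|u v|v u w].
- by apply/asboolP; exact: pres_refl.
- by apply/asboolP/asboolP => /pres_sym.
- by move=> /asboolP uv /asboolP vw; apply/asboolP; exact: pres_trans uv vw.
Qed.

Canonical pres_equiv := EquivRelPack pres_eqb_equiv.

Definition presented := {eq_quot pres_eqb}.
HB.instance Definition _ := Choice.on presented.

Definition word_class (w : word) : presented := \pi_({eq_quot pres_eqb}) w.

Lemma word_classP u v : word_class u = word_class v <-> pres_eq u v.
Proof.
split=> [/(@eqmodP _ pres_equiv)/asboolP //|uv].
by apply/(@eqmodP _ pres_equiv)/asboolP.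
Qed.

Lemma word_class_repr (x : presented) : word_class (repr x) = x.
Proof. exact: (@reprK _ {eq_quot pres_eqb}). Qed.

Lemma pres_repr w : pres_eq (repr (word_class w)) w.
Proof. by apply/word_classP; rewrite word_class_repr. Qed.

Lemma pres_cat2l x u v : pres_eq u v -> pres_eq (x ++ u) (x ++ v).
Proof.
elim=> {u v} [u|u v _|u v w _ uv _ vw|y l z|y u v z uv].
- exact: pres_refl.
- exact: pres_sym.
- exact: pres_trans uv vw.
- by rewrite !(catA x); exact: pres_free.
- by rewrite !(catA x); exact: pres_rel.
Qed.

Lemma pres_cat2r x u v : pres_eq u v -> pres_eq (u ++ x) (v ++ x).
Proof.
elim=> {u v} [u|u v _|u v w _ uv _ vw|y l z|y u v z uv].
- exact: pres_refl.
- exact: pres_sym.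
- exact: pres_trans uv vw.
- by rewrite -!catA; exact: pres_free.
- by rewrite -!catA; exact: pres_rel.
Qed.

Lemma pres_cat u u' v v' :
  pres_eq u u' -> pres_eq v v' -> pres_eq (u ++ v) (u' ++ v').
Proof.
by move=> uu vv; exact: pres_trans (pres_cat2r _ uu) (pres_cat2l _ vv).
Qed.

Lemma inv_letterK : involutive inv_letter.
Proof. by case=> a b; rewrite /inv_letter /= negbK. Qed.

Lemma inv_wordK : involutive inv_word.
Proof.
move=> w; rewrite /inv_word map_rev revK -map_comp.
by rewrite (eq_map inv_letterK) map_id.
Qed.

Lemma pres_mulV w : pres_eq (w ++ inv_word w) [::].
Proof.
elim: w => [|l w IH]; first exact: pres_refl.
rewrite /inv_word /= rev_cons -cats1 catA.
apply: pres_trans (pres_free [::] l [::]).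
by rewrite -cat1s -(cat1s l [:: inv_letter l]) -!catA; apply: pres_cat2l;
  rewrite catA; exact: (pres_cat2r [:: inv_letter l] IH).
Qed.

Lemma pres_Vmul w : pres_eq (inv_word w ++ w) [::].
Proof. by have := pres_mulV (inv_word w); rewrite inv_wordK. Qed.

Lemma pres_inv u v : pres_eq u v -> pres_eq (inv_word u) (inv_word v).
Proof.
move=> uv; have e1 : pres_eq (inv_word u) (inv_word u ++ v ++ inv_word v).
  rewrite -[X in pres_eq X]cats0; apply: pres_cat2l.
  exact/pres_sym/pres_mulV.
apply: (pres_trans e1); rewrite catA -[X in pres_eq _ X]cat0s.
apply: pres_cat2r; apply: pres_trans (pres_Vmul u).
exact/pres_cat2l/pres_sym.
Qed.

Definition pres_one : presented := word_class [::].
Definition pres_mul (x y : presented) : presented :=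
  word_class (repr x ++ repr y).
Definition pres_invg (x : presented) : presented :=
  word_class (inv_word (repr x)).

Lemma pres_mulE u v :
  pres_mul (word_class u) (word_class v) = word_class (u ++ v).
Proof. by apply/word_classP/pres_cat; exact: pres_repr. Qed.

Lemma pres_invE u : pres_invg (word_class u) = word_class (inv_word u).
Proof. by apply/word_classP/pres_inv; exact: pres_repr. Qed.

Lemma presented_mulA : associative pres_mul.
Proof.
move=> x y z; rewrite -(word_class_repr x) -(word_class_repr y).
by rewrite -(word_class_repr z) !pres_mulE catA.
Qed.

Lemma presented_mul1 : left_id pres_one pres_mul.
Proof. by move=> x; rewrite -(word_class_repr x) pres_mulE. Qed.

Lemma presented_mulr1 : right_id pres_one pres_mul.
Proof. by move=> x; rewrite -(word_class_repr x) pres_mulE cats0. Qed.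

Lemma presented_mulV : left_inverse pres_one pres_invg pres_mul.
Proof.
move=> x; rewrite -(word_class_repr x) pres_invE pres_mulE.
exact/word_classP/pres_Vmul.
Qed.

Lemma presented_mulrV : right_inverse pres_one pres_invg pres_mul.
Proof.
move=> x; rewrite -(word_class_repr x) pres_invE pres_mulE.
exact/word_classP/pres_mulV.
Qed.

HB.instance Definition _ := isGroup.Build presented presented_mulA
  presented_mul1 presented_mulr1 presented_mulV presented_mulrV.

End Presentation.

Section Groups.
Variable G : groupType.
Implicit Types (A : set (G -> G)) (f : G -> G).

Definition subgroup (H : set G) :=
  H 1%g /\ forall x y, H x -> H y -> H (x / y)%g.

Definition generated (B : set G) : set G := smallest subgroup B.

Definition lcoset (g : G) (H : set G) : set G := [set (g * h)%g | h in H].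

Definition automorphism f := bijective f /\ {morph f : x y / (x * y)%g}.

(* Subgroups of [Aut G], the group law being composition. *)
Definition aut_subgroup A :=
  [/\ A `<=` [set f | automorphism f], A id,
      (forall f1 f2, A f1 -> A f2 -> A (f1 \o f2)) &
      (forall f f', A f -> cancel f f' -> cancel f' f -> A f')].

Definition aut_generated A : set (G -> G) := smallest aut_subgroup A.

(* The opposite of the convention of [conjg], where [h ^ g = g^-1 * h * g]. *)
Definition inner (g : G) : G -> G := fun h => (g * h * g^-1)%g.

End Groups.

Section CompatibleAction.
Variables (R : realType) (X : Type) (d : X -> X -> R) (G : groupType).

Definition isometry (f : X -> X) :=
  bijective f /\ forall x y, d (f x) (f y) = d x y.

(* Values of [Psi] outside of [A] are irrelevant. *)
Definition compatible_action (Omega : G -> X -> X) (A : set (G -> G)) :=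
  range (@inner G) `<=` A /\
  exists Psi : (G -> G) -> (X -> X),
    [/\ forall f, A f -> isometry (Psi f),
        forall f1 f2, A f1 -> A f2 -> Psi (f1 \o f2) = Psi f1 \o Psi f2 &
        forall g, Psi (inner g) = Omega g].

End CompatibleAction.

(* [label a b] is only meaningful when [adj a b]; non-adjacent vertices have  *)
(* label infinity.                                                            *)
Record labelled_graph := LabelledGraph {
  vert :> finType;
  adj : rel vert;
  label : vert -> vert -> nat;
  adj_sym : symmetric adj;
  adj_irr : irreflexive adj;
  label_sym : forall a b, adj a b -> label a b = label b a;
  label_ge2 : forall a b, adj a b -> (2 <= label a b)%N
}.
Arguments adj {l}.
Arguments label {l}.

Definition connected_graph (Gamma : labelled_graph) :=
  forall a b : Gamma, connect adj a b.

Definition large_type (Gamma : labelled_graph) :=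
  forall a b : Gamma, adj a b -> (3 <= label a b)%N.

(* The word [a b a ...] of length [n]. *)
Fixpoint alt_word (V : Type) (n : nat) (a b : V) : seq (V * bool) :=
  if n is n'.+1 then (a, false) :: alt_word n' b a else [::].

Section Artin.
Variable Gamma : labelled_graph.

Definition braid_rel (u v : seq (Gamma * bool)) :=
  exists a b : Gamma,
    [/\ adj a b, u = alt_word (label a b) a b & v = alt_word (label a b) b a].

Definition artin : groupType := presented braid_rel.

Definition artin_gen (a : Gamma) : artin := word_class braid_rel [:: (a, false)].

Definition graph_perm (s : {perm Gamma}) :=
  (forall a b, adj (s a) (s b) = adj a b) /\
  (forall a b, adj a b -> label (s a) (s b) = label a b).

Definition graph_aut (f : artin -> artin) :=
  automorphism f /\
  exists2 s, graph_perm s & forall a, f (artin_gen a) = artin_gen (s a).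

Definition global_inversion (f : artin -> artin) :=
  automorphism f /\ forall a, f (artin_gen a) = (artin_gen a)^-1%g.

Definition AutGamma : set (artin -> artin) :=
  aut_generated (range (@inner artin) `|` graph_aut `|` global_inversion).

Definition parabolic (S : set Gamma) : set artin := generated (artin_gen @` S).

Definition spherical (S : set Gamma) :=
  [\/ S = set0, exists a, S = [set a] |
      exists a b, adj a b /\ S = [set a; b]].

Definition deligne_vertex (C : set artin) :=
  exists g S, spherical S /\ C = lcoset g (parabolic S).

Section Deligne.
Variable R : realType.

(* Points of the geometric realization are given by their barycentric         *)
(* coordinates.                                                               *)
Definition deligne_point (x : set artin -> R) :=
  [/\ forall C, 0 <= x C,
      finite_set [set C | x C != 0],
      [set C | x C != 0] `<=` deligne_vertex,
      forall C D, x C != 0 -> x D != 0 -> C `<=` D \/ D `<=` C &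
      \sum_(C \in [set: set artin]) x C = 1].

Definition deligne := {x : set artin -> R | deligne_point x}.

Definition supported (x : deligne) (s : set (set artin)) :=
  forall C, sval x C != 0 -> s C.

(* The point with barycentric coordinates [t0, t1, t2] of the Euclidean       *)
(* triangle with vertices [p0 = (1, 0)], [p1 = (0, 0)] and                    *)
(* [p2 = (0, cot (pi / 2m))].  Its angle is [pi / 2] at [p1] and [pi / 2m] at *)
(* [p2], and [p0 p1] has length 1.                                            *)
Definition triangle_point (m : nat) (t0 t1 t2 : R) : R * R :=
  (t0 * 1 + t1 * 0 + t2 * 0,
   t0 * 0 + t1 * 0 + t2 * (tan (pi / (2 * m)%:R))^-1).

Definition euclidean_dist (p q : R * R) : R :=
  Num.sqrt ((p.1 - q.1) ^+ 2 + (p.2 - q.2) ^+ 2).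

(* [simplex_dist x y r]: [x] and [y] lie in a common triangle, or in a common *)
(* edge [g A_0, g A_a] (which need not be in a triangle if [a] is an isolated *)
(* vertex), in which their distance is [r].                                   *)
Variant simplex_dist (x y : deligne) : R -> Prop :=
| TriangleDist (g : artin) (a b : Gamma) :
    let C0 := lcoset g (parabolic set0) in
    let C1 := lcoset g (parabolic [set a]) in
    let C2 := lcoset g (parabolic [set a; b]) in
    let pos (z : deligne) :=
      triangle_point (label a b) (sval z C0) (sval z C1) (sval z C2) in
    adj a b -> supported x [set C0; C1; C2] -> supported y [set C0; C1; C2] ->
    simplex_dist x y (euclidean_dist (pos x) (pos y))
| EdgeDist (g : artin) (a : Gamma) :
    let C0 := lcoset g (parabolic set0) in
    let C1 := lcoset g (parabolic [set a]) in
    supported x [set C0; C1] -> supported y [set C0; C1] ->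
    simplex_dist x y `|sval x C0 - sval y C0|.

(* [string_length x y r]: some piecewise linear path from [x] to [y], with    *)
(* each piece in a simplex, has length [r].                                   *)
Inductive string_length : deligne -> deligne -> R -> Prop :=
| string_nil x : string_length x x 0
| string_cons x y z r s :
    simplex_dist x y r -> string_length y z s -> string_length x z (r + s).

(* The infimum is over a nonempty set since the complex is connected. *)
Definition moussong_dist (x y : deligne) : R := inf [set r | string_length x y r].

Lemma preim_lcoset g k (H : set artin) :
  (fun h : artin => (g * h)%g) @^-1` lcoset k H = lcoset (g^-1 * k)%g H.
Proof.
apply/seteqP; split=> h /=.
  by move=> [l Hl e]; exists l; rewrite // -mulgA e mulKg.
by move=> [l Hl <-]; exists l; rewrite // !mulgA mulgV mul1g.
Qed.

Lemma preim_mulg g h (C : set artin) :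
  (fun l : artin => (g * l)%g) @^-1` ((fun l : artin => (h * l)%g) @^-1` C) =
  (fun l : artin => (h * g * l)%g) @^-1` C.
Proof. by apply/seteqP; split=> l /=; rewrite mulgA. Qed.

Lemma preim_mul1 (C : set artin) : (fun l : artin => (1 * l)%g) @^-1` C = C.
Proof. by apply/seteqP; split=> l /=; rewrite mul1g. Qed.

(* As [[set h | g * h \in C] = g^-1 C], this is [(g x) C = x (g^-1 C)]. *)
Definition translate (g : artin) (x : set artin -> R) : set artin -> R :=
  fun C => x ((fun h => (g * h)%g) @^-1` C).

Lemma translate_point g x : deligne_point x -> deligne_point (translate g x).
Proof.
pose T (k : artin) (C : set artin) := (fun h => (k * h)%g) @^-1` C.
have TK k : cancel (T k) (T k^-1%g).
  by move=> C; rewrite /T preim_mulg mulgV preim_mul1.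
have TVK k : cancel (T k^-1%g) (T k).
  by move=> C; rewrite /T preim_mulg mulVg preim_mul1.
case=> [x0 xfin xV xch x1]; split.
- by move=> C; exact: x0.
- apply: sub_finite_set (finite_image (T g^-1%g) xfin) => C /= nz.
  by exists (T g C); [exact: nz | exact: TK].
- move=> C /= nz; have [k [S [sS e]]] := xV _ nz.
  exists (g * k)%g, S; split=> //.
  rewrite -[LHS](TK g) /T e preim_lcoset.
  by congr lcoset; rewrite invgK.
- move=> C D nC nD; case: (xch _ _ nC nD) => sub; [left|right].
    by move=> h Ch; have := sub (g^-1 * h)%g; rewrite /= mulVKg; exact.
  by move=> h Ch; have := sub (g^-1 * h)%g; rewrite /= mulVKg; exact.
- rewrite -x1 [RHS](@reindex_fsbigT _ _ _ _ _ (T g)) //.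
  by exists (T g^-1%g); [exact: TK | exact: TVK].
Qed.

Definition deligne_act (g : artin) (x : deligne) : deligne :=
  exist _ (translate g (sval x)) (translate_point g (svalP x)).

End Deligne.
End Artin.

(* Main.v *)
Require Import Defs.
From mathcomp Require Import all_boot all_order perm all_algebra.
From mathcomp Require Import all_classical all_reals all_analysis.
From mathcomp Require fingroup.
From mathcomp Require Import ring lra zify.
Set Implicit Arguments.
Unset Strict Implicit.
Unset Printing Implicit Defensive.
Import Order.TTheory GRing.Theory Num.Theory numFieldNormedType.Exports.
Local Open Scope classical_set_scope.
Local Open Scope ring_scope.

(** An isometry [F] realizing [f] in [A] satisfies [F (k x) = f k (F x)], so it
    preserves the set of points with trivial stabilizer, which is the disjoint
    union of the open stars of the vertices [g A_0].  Barycentric coordinates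
    are Lipschitz for the Moussong metric, so these stars are open and closed in
    that set and [F] permutes them; after composing [f] with an inner
    automorphism, [F] maps the star of the vertex [1] into itself.  Passing to
    the closure and comparing stabilizers, [f] maps every standard spherical
    parabolic subgroup onto another one.

    Hence [f a = s(a)^(+-1)] for an injection [s] of the vertices preserving
    adjacency.  A linear representation of the Artin group by transvections (the
    reflection representation of the Hecke algebra at [q = -1]) shows that
    [c d^-1 c ...] never equals [d^-1 c d^-1 ...], so that the sign is constant
    on edges, and that an alternating product of positive generators satisfies
    the braid relation only from length [m_cd] on, so that [s] does not increase
    labels.  By finiteness [s] is a graph automorphism. *)

(** * Subgroups and alternating products *)

Section Subgroups.
Variable G : groupType.
Implicit Types (H K B : set G) (g h x y : G).

Lemma generated_subgroup B : subgroup (generated B).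
Proof.
split=> [H [sH _]|x y xB yB H sBH]; first by case: sH.
by case: (sBH) => -[_ HD] _; apply: HD; [exact: xB|exact: yB].
Qed.

Lemma subgroupV H x : subgroup H -> H x -> H x^-1%g.
Proof. by case=> H1 HD Hx; rewrite -div1g; exact: HD. Qed.

Lemma subgroupM H x y : subgroup H -> H x -> H y -> H (x * y)%g.
Proof.
by move=> sH Hx Hy; rewrite -[y]invgK; apply: (proj2 sH) => //; exact: subgroupV.
Qed.

Lemma lcosetP g h H : lcoset g H h <-> H (g^-1 * h)%g.
Proof.
split=> [[k Hk <-]|Hh]; first by rewrite mulKg.
by exists (g^-1 * h)%g; rewrite // mulVKg.
Qed.

Lemma lcoset_refl g H : subgroup H -> lcoset g H g.
Proof. by move=> sH; apply/lcosetP; rewrite mulVg; case: sH. Qed.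

Lemma lcoset_eq g h H : subgroup H -> lcoset g H h -> lcoset g H = lcoset h H.
Proof.
move=> sH /lcosetP gh; apply/seteqP; split=> k /lcosetP kH; apply/lcosetP.
  have -> : (h^-1 * k = (g^-1 * h)^-1 * (g^-1 * k))%g.
    by rewrite invgM invgK -mulgA mulVKg.
  by apply: subgroupM kH => //; exact: subgroupV.
have -> : (g^-1 * k = (g^-1 * h) * (h^-1 * k))%g by rewrite -mulgA mulVKg.
exact: subgroupM.
Qed.

Lemma lcoset_subset g H K : lcoset g H `<=` lcoset g K <-> H `<=` K.
Proof.
split=> sHK h; last by move=> [k Hk <-]; exists k => //; exact: sHK.
move=> Hh; have /sHK/lcosetP : lcoset g H (g * h)%g by exists h.
by rewrite mulKg.
Qed.

Lemma lcoset1 g : lcoset g [set 1%g] = [set g].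
Proof.
apply/seteqP; split=> h; first by move=> [k -> <-]; rewrite mulg1.
by move=> ->; exists 1%g; rewrite ?mulg1.
Qed.

Lemma morph1 (f : G -> G) : {morph f : x y / (x * y)%g} -> f 1%g = 1%g.
Proof. by move=> fM; apply: (mulgI (f 1%g)); rewrite -fM !mulg1. Qed.

Lemma morphV (f : G -> G) x : {morph f : x y / (x * y)%g} ->
  f x^-1%g = (f x)^-1%g.
Proof. by move=> fM; apply: (mulgI (f x)); rewrite -fM !mulgV morph1. Qed.

Lemma morphX (f : G -> G) x n : {morph f : x y / (x * y)%g} ->
  f (x ^+ n)%g = (f x ^+ n)%g.
Proof.
move=> fM; elim: n => [|n IH]; first by rewrite !expg0 morph1.
by rewrite !expgS fM IH.
Qed.

(** An integer power is encoded as a quotient of two natural powers; closure under division holds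
    because powers of [x] commute. *)
Lemma generated1 x :
  generated [set x] =
    [set (x ^+ n / x ^+ m)%g | n in [set: nat] & m in [set: nat]].
Proof.
apply/seteqP; split; last first.
  move=> _ [n _ [m _ <-]]; have sx := generated_subgroup [set x].
  have X k : generated [set x] (x ^+ k)%g.
    elim: k => [|k IH]; first by rewrite expg0; case: sx.
    rewrite expgS; apply: (subgroupM sx) => //.
    by apply: sub_gen_smallest.
  exact: (proj2 sx).
apply: smallest_sub; last first.
  by move=> _ ->; exists 1%N => //; exists 0%N => //; rewrite expg1 expg0 divg1.
split; first by exists 0%N => //; exists 0%N => //; rewrite expg0 divg1.
move=> _ _ [n _ [m _ <-]] [n' _ [m' _ <-]].
exists (n + m')%N => //; exists (n' + m)%N => //.
rewrite !expgnDr !invgM invgK -!mulgA; congr (_ * _)%g.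
have xC i j : (x ^+ i * x ^- j = x ^- j * x ^+ i)%g.
  have c : commute (x ^+ i) (x ^+ j) by apply: commuteX2.
  by apply: (mulIg (x ^+ j)%g); rewrite -mulgA mulVg mulg1 -mulgA c mulKg.
by rewrite !mulgA xC.
Qed.

Lemma commute_divX x n m : commute x (x ^+ n / x ^+ m)%g.
Proof.
have c k : commute x (x ^+ k)%g by apply: commuteX.
rewrite /commute mulgA (c n) -!mulgA; congr (_ * _)%g.
by apply: (mulgI (x ^+ m)%g); rewrite mulVKg mulgA -(c m) mulgK.
Qed.

Lemma generated1_commute x y z :
  generated [set x] y -> generated [set x] z -> commute y z.
Proof.
rewrite generated1 => -[n _ [m _ <-]] [n' _ [m' _ <-]].
set z0 := (x ^+ n' / x ^+ m')%g.
have c : commute z0 x by apply/esym/commute_divX.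
clearbody z0.
apply/esym; rewrite /commute; have cn k : commute z0 (x ^+ k)%g by apply: commuteX.
rewrite mulgA (cn n) -!mulgA; congr (_ * _)%g.
by apply: (mulgI (x ^+ m)%g); rewrite mulVKg mulgA -(cn m) mulgK.
Qed.

End Subgroups.

Section AlternatingProduct.
Variable G : groupType.

Fixpoint alt_prod (n : nat) (x y : G) : G :=
  if n is n'.+1 then (x * alt_prod n' y x)%g else 1%g.

Lemma alt_prod_morph (f : G -> G) n x y : {morph f : x y / (x * y)%g} ->
  f (alt_prod n x y) = alt_prod n (f x) (f y).
Proof.
by move=> fM; elim: n x y => [|n IH] x y /=; rewrite ?morph1 // fM IH.
Qed.

Lemma alt_prodSr n x y :
  alt_prod n.+1 x y = (alt_prod n x y * (if odd n then y else x))%g.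
Proof.
elim: n x y => [|n IH] x y; first by rewrite /= mul1g mulg1.
by rewrite [LHS]/= -/(alt_prod n.+1 y x) IH /= mulgA if_neg.
Qed.

Lemma alt_prodV n x y :
  (alt_prod n x y)^-1%g =
  if odd n then alt_prod n x^-1%g y^-1%g else alt_prod n y^-1%g x^-1%g.
Proof.
elim: n x y => [|n IH] x y; first by rewrite /= invg1.
by rewrite alt_prodSr invgM IH /=; case: (odd n).
Qed.

(** Inversion reverses both words, and for either parity the result is the braid relation for the
    inverses. Hence [a |-> a^-1] respects the Artin relations. *)
Lemma alt_prod_inv n x y : alt_prod n x y = alt_prod n y x ->
  alt_prod n x^-1%g y^-1%g = alt_prod n y^-1%g x^-1%g.
Proof. by move=> /(congr1 monoid.inv); rewrite !alt_prodV; case: ifP. Qed.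

End AlternatingProduct.

(** * Artin groups and parabolic subgroups *)

Section ArtinFacts.
Variable Gamma : labelled_graph.
Implicit Types (a b c d : Gamma) (S T : set Gamma).
Local Notation artin := (artin Gamma).
Local Notation gen := (@artin_gen Gamma).

Lemma parabolic_subgroup S : subgroup (parabolic S).
Proof. exact: generated_subgroup. Qed.

Lemma parabolic_gen S a : S a -> parabolic S (gen a).
Proof. by move=> Sa; apply: sub_gen_smallest; exists a. Qed.

Lemma parabolic_min S (H : set artin) : subgroup H ->
  (forall a, S a -> H (gen a)) -> parabolic S `<=` H.
Proof. by move=> sH SH; apply: smallest_sub => // _ [a Sa <-]; exact: SH. Qed.

Lemma parabolicS S T : S `<=` T -> parabolic S `<=` parabolic T.
Proof.
move=> ST; apply: parabolic_min; first exact: parabolic_subgroup.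
by move=> a /ST; exact: parabolic_gen.
Qed.

Lemma parabolic0 : parabolic (set0 : set Gamma) = [set 1%g].
Proof.
apply/seteqP; split; last by move=> _ ->; case: (parabolic_subgroup set0).
by apply: parabolic_min => //; split=> // x y -> ->; rewrite divg1.
Qed.

Lemma word_classM (u v : seq (Gamma * bool)) :
  word_class (@braid_rel Gamma) (u ++ v) =
  (word_class (@braid_rel Gamma) u * word_class (@braid_rel Gamma) v)%g.
Proof. by rewrite -pres_mulE. Qed.

Lemma word_class_gen a e :
  word_class (@braid_rel Gamma) [:: (a, e)] = (if e then (gen a)^-1 else gen a)%g.
Proof.
by case: e => //; symmetry; exact: (pres_invE (@braid_rel Gamma) [:: (a, false)]).
Qed.

Lemma word_class_alt n a b :
  word_class (@braid_rel Gamma) (alt_word n a b) = alt_prod n (gen a) (gen b).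
Proof. by elim: n a b => [|n IH] a b //=; rewrite -cat1s word_classM IH. Qed.

Lemma artin_braid a b : adj a b ->
  alt_prod (label a b) (gen a) (gen b) = alt_prod (label a b) (gen b) (gen a).
Proof.
move=> ab; rewrite -!word_class_alt; apply/word_classP.
have ab_rel : braid_rel (alt_word (label a b) a b) (alt_word (label a b) b a).
  by exists a, b.
by have := pres_rel [::] [::] ab_rel; rewrite !cats0.
Qed.

Lemma artin_ind (P : artin -> Prop) : P 1%g ->
  (forall a x, P x -> P (gen a * x)%g) ->
  (forall a x, P x -> P ((gen a)^-1 * x)%g) -> forall x, P x.
Proof.
move=> P1 PM PV x; rewrite -(word_class_repr x); elim: (repr x) => [//|[a e] w IH].
rewrite -cat1s word_classM word_class_gen.
by case: e; [exact: PV|exact: PM].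
Qed.

Lemma artin_hom_ext (f g : artin -> artin) :
  {morph f : x y / (x * y)%g} -> {morph g : x y / (x * y)%g} ->
  (forall a, f (gen a) = g (gen a)) -> f = g.
Proof.
move=> fM gM fg.
apply/funext; elim/artin_ind => [|a x IH|a x IH]; first by rewrite !morph1.
  by rewrite fM gM fg IH.
by rewrite fM gM !morphV // fg IH.
Qed.

End ArtinFacts.

(** * A representation by transvections *)

Section Chebyshev.
Variable R : realType.
Implicit Types (x y u t s : R).

(* The coefficient of [e_a] contributed by [alt_word n a b] acting on a vector on
   which the forms of [a] and [b] take the values [x] and [y], when the form of
   [a] is [u] at [e_b] and that of [b] is [- u] at [e_a]. *)
Fixpoint alt_coef (n : nat) u x y : R :=
  if n is n1.+1 then
    (if n1 is n2.+1 then alt_coef n2 u x y else 0) - x - u * alt_coef n1 (- u) y x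
  else 0.

Lemma alt_coefSS n u x y :
  alt_coef n.+2 u x y = alt_coef n u x y - x - u * alt_coef n.+1 (- u) y x.
Proof. by []. Qed.

(** First differences cancel the constant term [- x] and leave a homogeneous recurrence. At [n = 0]
    the convention [0.-1 = 0] makes the first difference on the right vanish. *)
Lemma alt_coef_diff n u x y :
  alt_coef n.+2 u x y - alt_coef n.+1 u x y =
  alt_coef n u x y - alt_coef n.-1 u x y
  - u * (alt_coef n.+1 (- u) y x - alt_coef n (- u) y x).
Proof.
case: n => [|n]; first by rewrite /=; ring.
by rewrite [in LHS]alt_coefSS (alt_coefSS n u) [n.+1.-1]/=; ring.
Qed.

Lemma sin_recr n t :
  sin (n.+2%:R * t) = 2 * cos t * sin (n.+1%:R * t) - sin (n%:R * t).
Proof.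
have -> : n.+2%:R * t = n.+1%:R * t + t by rewrite -[n.+2]addn1 natrD; ring.
have -> : n%:R * t = n.+1%:R * t - t by rewrite -[n.+1]addn1 natrD; ring.
by rewrite !sinD sinN cosN; ring.
Qed.

(** Up to sign and a factor [x] or [y], the differences are the Chebyshev values
    [sin (n t) / sin t]. The recurrence exchanges [(u, x, y)] with [(- u, y, x)], so the induction
    treats both signs [s] and both parities at once. *)
Lemma alt_coef_sin k s t x y : s * s = 1 ->
  let u := s * (2 * cos t) in
  sin t * (alt_coef (2 * k) u x y - alt_coef (2 * k).-1 u x y) =
    - (-1) ^+ k * s * sin ((2 * k)%:R * t) * y /\
  sin t * (alt_coef (2 * k).+1 u x y - alt_coef (2 * k) u x y) =
    - (-1) ^+ k * sin ((2 * k).+1%:R * t) * x.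
Proof.
move=> + u; elim: k s @u x y => [|k IH] s u x y s1.
  by rewrite muln0 /= mul1r mul0r sin0; split; ring.
have [e1 e2] := IH s x y s1.
have sN : - s * - s = 1 by rewrite mulrNN.
have [f1 f2] := IH _ y x sN.
rewrite -/u in e1 e2; rewrite (mulNr s (2 * cos t)) -/u in f1 f2.
have -> : (2 * k.+1 = (2 * k).+2)%N by rewrite mulnS add2n.
rewrite !exprS.
have g1 : sin t * (alt_coef (2 * k).+2 u x y - alt_coef (2 * k).+1 u x y) =
    (-1) ^+ k * s * sin ((2 * k).+2%:R * t) * y.
  rewrite alt_coef_diff mulrBr e1 mulrCA f2 sin_recr /u; ring.
have g2 : sin t * (alt_coef (2 * k).+2 (- u) y x - alt_coef (2 * k).+1 (- u) y x) =
    - ((-1) ^+ k * s * sin ((2 * k).+2%:R * t) * x).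
  rewrite alt_coef_diff mulrBr f1 mulrCA opprK e2 sin_recr /u; ring.
split; first by rewrite g1; ring.
rewrite alt_coef_diff mulrBr e2 mulrCA g2 [in RHS]sin_recr /u.
transitivity (- (-1) ^+ k * sin ((2 * k).+1%:R * t) * x
  + (s * s) * (2 * cos t) * ((-1) ^+ k * sin ((2 * k).+2%:R * t) * x)); first by ring.
by rewrite s1; ring.
Qed.

Lemma alt_coef_stable n s t x y : s * s = 1 -> sin t != 0 -> (0 < n)%N ->
  sin (n%:R * t) = 0 ->
  alt_coef n (s * (2 * cos t)) x y = alt_coef n.-1 (s * (2 * cos t)) x y.
Proof.
move=> s1 t0 n0 nt; apply/eqP; rewrite -subr_eq0; apply/eqP.
apply: (mulfI t0); rewrite mulr0.
have [e1 e2] := @alt_coef_sin n./2 s t x y s1.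
move: e1 e2; rewrite mul2n; case: (boolP (odd n)) => on.
  move=> _; have -> : n./2.*2.+1 = n by rewrite -[RHS]odd_double_half on.
  have -> : n./2.*2 = n.-1 by rewrite -[n in n.-1]odd_double_half on.
  by move=> ->; rewrite nt; ring.
move=> + _; have -> : n./2.*2 = n by rewrite -[RHS]odd_double_half (negbTE on).
by move=> ->; rewrite nt; ring.
Qed.

Lemma alt_coef_unstable n s t : s * s = 1 -> (0 < n)%N ->
  alt_coef n (s * (2 * cos t)) 1 1 = alt_coef n.-1 (s * (2 * cos t)) 1 1 ->
  sin (n%:R * t) = 0.
Proof.
move=> s1 n0 /eqP; rewrite -subr_eq0 => /eqP d0.
have [e1 e2] := @alt_coef_sin n./2 s t 1 1 s1.
have sg0 : (-1) ^+ n./2 != 0 :> R by rewrite expf_neq0 // oppr_eq0 oner_neq0.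
have s0 : s != 0 by apply/eqP => s0; move/eqP: s1; rewrite s0 mul0r eq_sym oner_eq0.
move: e1 e2; rewrite mul2n; case: (boolP (odd n)) => on.
  move=> _; have -> : n./2.*2.+1 = n by rewrite -[RHS]odd_double_half on.
  have -> : n./2.*2 = n.-1 by rewrite -[n in n.-1]odd_double_half on.
  rewrite d0 mulr0 mulr1 mulNr => /esym/eqP; rewrite oppr_eq0 mulf_eq0.
  by rewrite (negbTE sg0) /= => /eqP.
move=> + _; have -> : n./2.*2 = n by rewrite -[RHS]odd_double_half (negbTE on).
rewrite d0 mulr0 mulr1 !mulNr => /esym/eqP; rewrite oppr_eq0 !mulf_eq0.
by rewrite (negbTE sg0) (negbTE s0) /= => /eqP.
Qed.

Lemma sin_multiple_pi (m : nat) : (0 < m)%N -> sin (m%:R * (pi / m%:R)) = 0 :> R.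
Proof. by move=> m0; rewrite mulrC divfK ?sinpi // pnatr_eq0 -lt0n. Qed.

Lemma sin_fraction_pi (m n : nat) : (0 < n < m)%N -> 0 < sin (n%:R * (pi / m%:R)) :> R.
Proof.
move=> /andP[n0 nm]; have m0 : (0 < m)%N by apply: leq_trans nm.
apply: sin_gt0_pi; apply/andP; split.
  by rewrite mulr_gt0 ?ltr0n // divr_gt0 ?pi_gt0 ?ltr0n.
rewrite mulrA ltr_pdivrMr ?ltr0n // mulrC ltr_pM2l ?pi_gt0 //.
by rewrite ltr_nat.
Qed.

(** Cosine decreases on [[0, pi]], and [2 cos (pi / 3) = 1] follows from
    [sin (2 pi / 3) = sin (pi / 3)]. This is how large type enters [alt_prod_mixed_neq]. *)
Lemma cos_label_ge1 (m : nat) : (3 <= m)%N -> 1 <= 2 * cos (pi / m%:R) :> R.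
Proof.
move=> m3.
have s3 : 0 < sin (pi / 3) :> R.
  by have := @sin_fraction_pi 3 1 isT; rewrite mul1r.
have c3 : 2 * cos (pi / 3) = 1 :> R.
  have := @sin_recr 0 (pi / 3); rewrite mul1r mul0r sin0 subr0.
  have -> : 2 * (pi / 3) = pi - pi / 3 :> R by field.
  rewrite sinB sinpi cospi mul0r sub0r mulN1r opprK => /eqP.
  by rewrite -{1}[sin _]mul1r -subr_eq0 -mulrBl mulf_eq0 (gt_eqF s3) orbF
    subr_eq0 => /eqP.
rewrite -[leLHS]c3 ler_pM2l // leNgt ltr_cos.
- by rewrite -leNgt ler_pM2l ?pi_gt0 // lef_pV2 ?posrE ?ltr0n // ?ler_nat //; lia.
- rewrite in_itv /= divr_ge0 ?pi_ge0 //= ler_pdivrMr ?ltr0n ?ler_peMr ?pi_ge0 //.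
    by rewrite ler1n.
- rewrite in_itv /= divr_ge0 ?pi_ge0 //= ler_pdivrMr ?ltr0n ?ler_peMr ?pi_ge0 //.
    by rewrite ler1n; lia.
  lia.
Qed.

End Chebyshev.

(** * The transvection representation and its consequences for words *)

Section Representation.
Variables (R : realType) (Gamma : labelled_graph).
Hypothesis Gamma_large : large_type Gamma.
Implicit Types (a b c d : Gamma) (S T : set Gamma).
Local Notation artin := (artin Gamma).
Local Notation gen := (@artin_gen Gamma).
Local Notation space := (option Gamma -> R).
Implicit Types (v w : space) (x y : artin).

(** Opposite signs at the two ends of an edge make [pairing] skew-symmetric. The product of two
    adjacent generators then has trace [2 - 4 cos^2 (pi / m)] on the plane of [e_a] and [e_b],
    matching a braid relation of length [m]. *)
Definition edge_sign a b : R := if (enum_rank a < enum_rank b)%N then 1 else -1.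

(* Since [beta a] vanishes at [e_a], a generator acts by the transvection
   [v - beta a v * e_a].  The additional basis vector [None], at which every form
   is 1, makes all generators act nontrivially, including isolated ones. *)
Definition pairing a (i : option Gamma) : R :=
  if i is Some b then
    if adj a b then edge_sign a b * (2 * cos (pi / (label a b)%:R)) else 0
  else 1.

Arguments pairing : simpl never.

Lemma pairing_None a : pairing a None = 1.
Proof. by []. Qed.

Definition beta a v : R := \sum_i pairing a i * v i.

Definition shift v (t : R) a : space := fun i => v i + t * (i == Some a)%:R.

Definition letter_act (l : Gamma * bool) v : space :=
  shift v (if l.2 then beta l.1 v else - beta l.1 v) l.1.

Definition word_act (u : seq (Gamma * bool)) v : space := foldr letter_act v u.

Lemma edge_sign_sqr a b : edge_sign a b * edge_sign a b = 1.
Proof. by rewrite /edge_sign; case: ifP => _; ring. Qed.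

Lemma pairingC a b : pairing b (Some a) = - pairing a (Some b).
Proof.
rewrite /pairing adj_sym; case: ifP => [ba|_]; last by rewrite oppr0.
rewrite (label_sym ba) -mulNr; congr (_ * _); rewrite /edge_sign.
case: (ltngtP (enum_rank a) (enum_rank b)) => [_|_|/val_inj/enum_rank_inj e]; try ring.
by move: ba; rewrite e adj_irr.
Qed.

Lemma pairing_self a : pairing a (Some a) = 0.
Proof. by rewrite /pairing adj_irr. Qed.

Lemma beta_shift a v t b : beta a (shift v t b) = beta a v + t * pairing a (Some b).
Proof.
rewrite /beta /shift; under eq_bigr do rewrite mulrDr.
rewrite big_split /= [X in _ + X = _](bigD1 (Some b)) //= eqxx mulr1.
rewrite [X in _ + (_ + X)]big1 ?addr0 1?mulrC // => i /negbTE ->.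
by rewrite !mulr0.
Qed.

Lemma shiftD v t s a : shift (shift v t a) s a = shift v (t + s) a.
Proof. by apply/funext => i; rewrite /shift; ring. Qed.

Lemma shiftC v t a s b : shift (shift v t a) s b = shift (shift v s b) t a.
Proof. by apply/funext => i; rewrite /shift; ring. Qed.

Lemma shift0 v a : shift v 0 a = v.
Proof. by apply/funext => i; rewrite /shift; ring. Qed.

Lemma letter_actK l v : letter_act l (letter_act (inv_letter l) v) = v.
Proof.
case: l => a e; rewrite /letter_act /= beta_shift pairing_self mulr0 addr0 shiftD.
by case: e => /=; rewrite (addNr, subrr) shift0.
Qed.

(** The tail after the first letter [a] is the alternating word of length [n - 1] starting with [b],
    and [a] leaves the coordinate at [e_b] alone; hence the index [n.-1] and the exchanged
    arguments. *)
Lemma alt_word_act n a b v :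
  word_act (alt_word n a b) v =
  shift (shift v (alt_coef n (pairing a (Some b)) (beta a v) (beta b v)) a)
    (alt_coef n.-1 (- pairing a (Some b)) (beta b v) (beta a v)) b.
Proof.
elim: n a b => [|n IH] a b; first by rewrite /= !shift0.
rewrite [LHS]/= IH /letter_act /= !beta_shift pairing_self (pairingC a b) opprK.
rewrite [in LHS]shiftC shiftD [in LHS]shiftC; congr (shift (shift _ _ _) _ _).
by case: n {IH} => [|n] /=; ring.
Qed.

Lemma label_gt0 a b : adj a b -> (0 < label a b)%N.
Proof. by move/Gamma_large; apply: leq_trans. Qed.

Lemma pairing_adj a b : adj a b ->
  pairing a (Some b) = edge_sign a b * (2 * cos (pi / (label a b)%:R)).
Proof. by move=> ab; rewrite /pairing ab. Qed.

Lemma sin_label_neq0 a b : adj a b -> sin (pi / (label a b)%:R) != 0 :> R.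
Proof.
move=> /Gamma_large m3; rewrite gt_eqF // -[X in sin X]mul1r.
by apply: (@sin_fraction_pi R (label a b) 1); rewrite /=; lia.
Qed.

Lemma alt_coef_braid a b (t s : R) : adj a b ->
  alt_coef (label a b) (pairing a (Some b)) t s =
  alt_coef (label a b).-1 (pairing a (Some b)) t s.
Proof.
move=> ab; rewrite pairing_adj //; apply: alt_coef_stable.
- exact: edge_sign_sqr.
- exact: sin_label_neq0.
- exact: label_gt0.
- by rewrite sin_multiple_pi // label_gt0.
Qed.

(** The two sides give [e_a] the coefficients of index [m] and [m - 1], and similarly for [e_b];
    these agree since [sin (m * (pi / m)) = 0]. *)
Lemma word_act_braid a b v : adj a b ->
  word_act (alt_word (label a b) a b) v = word_act (alt_word (label a b) b a) v.
Proof.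
move=> ab; rewrite !alt_word_act (pairingC a b) opprK [in RHS]shiftC.
have ba : adj b a by rewrite adj_sym.
congr (shift (shift _ _ _) _ _); first exact: alt_coef_braid.
by rewrite -pairingC (label_sym ab) alt_coef_braid.
Qed.

Lemma word_act_cat u1 u2 v : word_act (u1 ++ u2) v = word_act u1 (word_act u2 v).
Proof. exact: foldr_cat. Qed.

Lemma word_act_pres u1 u2 : pres_eq (@braid_rel Gamma) u1 u2 ->
  word_act u1 = word_act u2.
Proof.
elim=> {u1 u2} // [u1 u2 u3 _ -> _ -> //|u1 l u2|u1 _ _ u2 [a [b [ab -> ->]]]];
  apply/funext => v; rewrite !word_act_cat //.
  by congr (word_act u1 _); exact: letter_actK.
by rewrite word_act_braid.
Qed.

Definition rho x v : space := word_act (repr x) v.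

Lemma rho_word u v : rho (word_class (@braid_rel Gamma) u) v = word_act u v.
Proof. by rewrite /rho (word_act_pres (pres_repr _ u)). Qed.

Lemma rhoM x y v : rho (x * y)%g v = rho x (rho y v).
Proof.
by rewrite -(word_class_repr x) -(word_class_repr y) -word_classM !rho_word
  word_act_cat.
Qed.

Lemma rho1 v : rho 1%g v = v.
Proof. exact: (rho_word [::]). Qed.

Lemma rhoK x v : rho x (rho x^-1%g v) = v.
Proof. by rewrite -rhoM mulgV rho1. Qed.

Lemma rho_gen a v : rho (gen a) v = shift v (- beta a v) a.
Proof. exact: (rho_word [:: (a, false)]). Qed.

Lemma rho_genV a v : rho (gen a)^-1%g v = shift v (beta a v) a.
Proof. by rewrite -(word_class_gen a true) rho_word. Qed.

Definition dirac_vec (j : option Gamma) : space := fun i => (i == j)%:R.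

Lemma beta_dirac a j : beta a (dirac_vec j) = pairing a j.
Proof.
rewrite /beta (bigD1 j) //= /dirac_vec eqxx mulr1 big1 ?addr0 // => i /negbTE ->.
by rewrite mulr0.
Qed.

(** The elements preserving all coordinates outside [S] form a subgroup containing [parabolic S],
    while [gen a] changes the coordinate [a] of [e_None]. This separates the standard parabolic
    subgroups. *)
Lemma parabolic_genP S a : parabolic S (gen a) <-> S a.
Proof.
split; last exact: parabolic_gen.
move=> Sa; apply: contrapT => nSa.
pose H : set artin := fun x => forall v d, ~ S d -> rho x v (Some d) = v (Some d).
have sH : subgroup H.
  split=> [v d _|x y Hx Hy v d nS]; first by rewrite rho1.
  rewrite rhoM Hx //; have := Hy (rho y^-1%g v) d nS; rewrite rhoK.
  by move->.
have /(_ (gen a) Sa (dirac_vec None) a nSa) : parabolic S `<=` H.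
  apply: parabolic_min => // b Sb v d nS; rewrite rho_gen /shift.
  have /negbTE -> : Some d != Some b by apply/eqP => -[e]; rewrite e in nS.
  by rewrite mulr0 addr0.
rewrite rho_gen /shift beta_dirac /dirac_vec eqxx /= pairing_None => /eqP.
by rewrite mulr1 add0r oppr_eq0 oner_eq0.
Qed.

Lemma rho_gen_dirac c n :
  rho (gen c ^+ n)%g (dirac_vec None) = shift (dirac_vec None) (- n%:R) c.
Proof.
elim: n => [|n IH]; first by rewrite expg0 rho1 oppr0 shift0.
rewrite expgS rhoM IH rho_gen shiftD beta_shift pairing_self beta_dirac pairing_None.
by congr shift; rewrite -[in RHS]addn1 natrD; ring.
Qed.

(** [gen c ^+ n] sends [e_None] to [e_None - n e_c], so generators have infinite order. *)
Lemma gen_expg_inj c n m : (gen c ^+ n = gen c ^+ m)%g -> n = m.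
Proof.
move=> e; have := rho_gen_dirac c n; rewrite e rho_gen_dirac.
move=> /(congr1 (@^~ (Some c))); rewrite /shift /dirac_vec eqxx /= mulr1 !add0r mulr1.
by move=> /oppr_inj/eqP; rewrite eqr_nat => /eqP.
Qed.

(** All forms equal 1 on [e_None], so comparing coordinates at [c] gives [sin (n * (pi / m)) = 0]
    for [m = label c d], which fails for [0 < n < m]. *)
Lemma alt_prod_gen_inj n c d : adj c d -> (0 < n)%N ->
  alt_prod n (gen c) (gen d) = alt_prod n (gen d) (gen c) -> (label c d <= n)%N.
Proof.
move=> cd n0; rewrite -!word_class_alt => e; rewrite leqNgt; apply/negP => nm.
have := rho_word (alt_word n c d) (dirac_vec None).
rewrite e rho_word !alt_word_act !beta_dirac !pairing_None => /(congr1 (@^~ (Some c))).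
have dc : Some c == Some d = false.
  by apply/eqP => -[dc]; move: cd; rewrite dc adj_irr.
rewrite /shift /dirac_vec eqxx dc /= !(mulr0, mulr1, addr0, add0r).
rewrite pairingC opprK pairing_adj // => /esym/alt_coef_unstable.
move=> /(_ (edge_sign_sqr _ _) n0) /eqP; rewrite gt_eqF // sin_fraction_pi //.
by rewrite n0.
Qed.

(* On suitably signed multiples of [e_c] and [e_d], [gen c] and [(gen d)^-1] act
   by [(p, q) |-> (p + t q, q)] and [(p, q) |-> (p, q + t p)] with [t >= 1], so
   the leftmost factor of the product decides which coordinate is larger. *)
Lemma alt_prod_mixed_neq n c d : adj c d -> (0 < n)%N ->
  alt_prod n (gen c) (gen d)^-1%g <> alt_prod n (gen d)^-1%g (gen c).
Proof.
move=> cd n0 e; have dc : d == c = false.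
  by apply/eqP => dc; move: cd; rewrite dc adj_irr.
pose s := edge_sign c d; pose t : R := 2 * cos (pi / (label c d)%:R).
have t1 : 1 <= t by apply: cos_label_ge1; exact: Gamma_large.
have ss : s * s = 1 by exact: edge_sign_sqr.
pose V (p q : R) : space := shift (shift (fun=> 0) p c) (- s * q) d.
have bc p q : beta c (V p q) = - t * q.
  rewrite !beta_shift pairing_self pairing_adj // -/s -/t /beta.
  rewrite big1; last by move=> i _; rewrite mulr0.
  by rewrite mulr0 !add0r; transitivity (- (s * s) * t * q); [ring|rewrite ss; ring].
have bd p q : beta d (V p q) = - s * t * p.
  rewrite !beta_shift pairing_self pairingC pairing_adj // -/s -/t /beta.
  rewrite big1; last by move=> i _; rewrite mulr0.
  by ring.
have Vc p q : rho (gen c) (V p q) = V (p + t * q) q.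
  by rewrite rho_gen bc /V shiftC shiftD; congr (shift (shift _ _ _) _ _); ring.
have Vd p q : rho (gen d)^-1%g (V p q) = V p (q + t * p).
  by rewrite rho_genV bd /V shiftD; congr (shift (shift _ _ _) _ _); ring.
have step k : exists p q p' q' : R, [/\ 0 < p, 0 < q, 0 < p', 0 < q' &
    [/\ rho (alt_prod k (gen c) (gen d)^-1%g) (V 1 1) = V p q,
      rho (alt_prod k (gen d)^-1%g (gen c)) (V 1 1) = V p' q',
      (0 < k)%N -> q < p & (0 < k)%N -> p' < q']].
  clear e; elim: k => [|k [p [q [p' [q' [p0 q0 p'0 q'0 [e1 e2 _ _]]]]]]].
    by exists 1, 1, 1, 1; split=> //; split=> //=; rewrite rho1.
  have tq : q' <= t * q' by rewrite ler_peMl // ltW.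
  have tp : p <= t * p by rewrite ler_peMl // ltW.
  exists (p' + t * q'), q', p, (q + t * p).
  split; [clear e1 e2; lra|by []|by []|clear e1 e2; lra|].
  by split=> [||_|_]; rewrite /= ?rhoM ?e1 ?e2 ?Vc ?Vd //; clear e1 e2; lra.
have [p [q [p' [q' [_ _ _ _ [e1 e2 /(_ n0) qp /(_ n0) pq]]]]]] := step n.
rewrite e e2 in e1.
have := congr1 (@^~ (Some c)) e1; have := congr1 (@^~ (Some d)) e1.
rewrite /V /shift !(inj_eq (@Some_inj _)) !eqxx dc eq_sym dc /=.
rewrite !mulr0 !mulr1 !add0r !addr0 => eq ep; rewrite ep in pq.
have s0 : - s != 0.
  rewrite oppr_eq0; apply/eqP => s0; move: ss; rewrite s0 mul0r => /esym/eqP.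
  by rewrite oner_eq0.
move: eq => /(mulfI s0) eqq; rewrite eqq in pq.
by have := lt_trans pq qp; rewrite ltxx.
Qed.

End Representation.

(** * Automorphisms preserving spherical parabolic subgroups *)

Section ArtinLift.
Variable Gamma : labelled_graph.
Local Notation artin := (artin Gamma).
Local Notation gen := (@artin_gen Gamma).

Lemma artin_lift (phi : Gamma -> artin) :
  (forall a b, adj a b -> alt_prod (label a b) (phi a) (phi b) =
                          alt_prod (label a b) (phi b) (phi a)) ->
  exists2 h : artin -> artin, {morph h : x y / (x * y)%g} &
    forall a, h (gen a) = phi a.
Proof.
move=> phi_braid.
pose ev (u : seq (Gamma * bool)) : artin :=
  foldr (fun l x => (if l.2 then (phi l.1)^-1 else phi l.1) * x)%g 1%g u.
have ev_cat u v : ev (u ++ v) = (ev u * ev v)%g.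
  by elim: u => [|l u IH] /=; rewrite ?mul1g // IH mulgA.
have ev_alt n a b : ev (alt_word n a b) = alt_prod n (phi a) (phi b).
  by elim: n a b => [|n IH] a b //=; rewrite IH.
have ev_pres u v : pres_eq (@braid_rel Gamma) u v -> ev u = ev v.
  elim=> {u v} // [u v w _ -> _ -> //|u [a e] v|u _ _ v [a [b [ab -> ->]]]].
    rewrite !ev_cat; congr (_ * _)%g; rewrite -[RHS]mul1g; congr (_ * _)%g.
    by rewrite /= mulg1; case: e; rewrite /= ?mulVg ?mulgV.
  by rewrite !ev_cat !ev_alt phi_braid.
have evE u : ev (repr (word_class (@braid_rel Gamma) u)) = ev u.
  exact/ev_pres/pres_repr.
exists (fun x => ev (repr x)) => [x y|a]; last by rewrite evE /= mulg1.
rewrite -[in LHS](word_class_repr x) -[in LHS](word_class_repr y).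
by rewrite -word_classM evE ev_cat.
Qed.

Lemma exists_global_inversion : exists iota : artin -> artin,
  global_inversion iota /\ cancel iota iota.
Proof.
have [|iota iM iE] := @artin_lift (fun a => (gen a)^-1%g).
  by move=> a b /artin_braid/alt_prod_inv.
have iK : cancel iota iota.
  have iiE : iota \o iota = id.
    by apply: artin_hom_ext => // [y z|a] /=; rewrite ?iM // iE morphV // iE invgK.
  by move=> x; rewrite -[LHS]/((iota \o iota) x) iiE.
by exists iota; split=> //; split=> //; split=> //; exists iota.
Qed.

End ArtinLift.

Section LabelledGraphPerm.
Variable Gamma : labelled_graph.

(** A permutation of a finite set has finite order, so its inverse is one of its iterates and
    satisfies the same hypothesis. Both inequalities between labels then hold, and adjacency is
    reflected. *)
Lemma graph_perm_of_mono (s : {perm Gamma}) :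
  (forall a b, adj a b -> adj (s a) (s b) /\ (label (s a) (s b) <= label a b)%N) ->
  graph_perm s.
Proof.
move=> smono.
have it k a b : adj a b -> adj (iter k s a) (iter k s b) /\
    (label (iter k s a) (iter k s b) <= label a b)%N.
  elim: k => [//|k IH] ab; have [kab le] := IH ab.
  have [kab' le'] := smono _ _ kab.
  by split=> //=; apply: leq_trans le.
have sK a : iter (fingroup.order s).-1 s (s a) = a.
  by rewrite -iterSr prednK ?fingroup.order_gt0 // -permX fingroup.expg_order perm1.
split=> [a b|a b ab].
  by apply/idP/idP => [/(it (fingroup.order s).-1)[]|/smono[]//]; rewrite !sK.
have [sab le] := smono _ _ ab; have [_] := it (fingroup.order s).-1 _ _ sab.
by rewrite !sK => le'; apply/eqP; rewrite eqn_leq le le'.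
Qed.

End LabelledGraphPerm.

Section ParabolicPreserving.
Variables (R : realType) (Gamma : labelled_graph).
Hypothesis Gamma_connected : connected_graph Gamma.
Hypothesis Gamma_large : large_type Gamma.
Local Notation artin := (artin Gamma).
Local Notation gen := (@artin_gen Gamma).
Implicit Types (f : artin -> artin) (a b c d : Gamma).

Lemma AutGamma_gen f : range (@inner artin) f \/ graph_aut f \/ global_inversion f ->
  AutGamma f.
Proof.
move=> gf; apply: sub_gen_smallest.
by case: gf => [|[]]; [left; left|left; right|right].
Qed.

Lemma AutGamma_comp f1 f2 : AutGamma f1 -> AutGamma f2 -> AutGamma (f1 \o f2).
Proof.
move=> A1 A2 H sH; have [[_ _ HM _] _] := sH.
by apply: HM; [exact: A1|exact: A2].
Qed.

Lemma parabolic1 a : parabolic [set a] = generated [set gen a].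
Proof. by rewrite /parabolic image_set1. Qed.

Lemma gen_noncommute c d : adj c d -> ~ commute (gen c) (gen d).
Proof.
move=> cd cC; have := @alt_prod_gen_inj R Gamma Gamma_large 2 c d cd isT.
rewrite /= !mulg1 => /(_ cC); apply/negP; rewrite -ltnNge.
exact: Gamma_large.
Qed.

(** * The vertex map induced by an automorphism *)

Section VertexMap.
Variable f : artin -> artin.
Hypothesis f_aut : automorphism f.
Hypothesis f_parabolic : forall S, spherical S ->
  exists2 T, spherical T & f @` parabolic S = parabolic T.

Lemma automorphism_inj : injective f.
Proof. by case: f_aut => /bij_inj. Qed.

Lemma automorphism_morph : {morph f : x y / (x * y)%g}.
Proof. by case: f_aut. Qed.

Lemma automorphism_image_inj (A B : set artin) : f @` A = f @` B -> A = B.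
Proof.
move=> e; apply/seteqP; split=> x Ax.
  by have : (f @` B) (f x); [rewrite -e; exists x|move=> [y By /automorphism_inj <-]].
by have : (f @` A) (f x); [rewrite e; exists x|move=> [y By /automorphism_inj <-]].
Qed.

(** The image is nontrivial and abelian, whereas the two generators of an edge group do not commute;
    only rank one is left. *)
Lemma rank1_image : exists s : Gamma -> Gamma,
  forall a, f @` parabolic [set a] = parabolic [set s a].
Proof.
suff /choice[s] : forall a, exists c, f @` parabolic [set a] = parabolic [set c].
  by exists s.
move=> a; have sph : spherical [set a] by apply: Or32; exists a.
have [T sT e] := f_parabolic sph.
case: sT => [T0|[c Tc]|[c [d [cd Tcd]]]].
- have : (f @` parabolic [set a]) (f (gen a)).
    by exists (gen a) => //; exact: parabolic_gen.
  rewrite e T0 parabolic0 => fa1; have : gen a = 1%g.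
    by apply: automorphism_inj; rewrite fa1 morph1 //; exact: automorphism_morph.
  move=> ga1; have : parabolic (set0 : set Gamma) (gen a) by rewrite parabolic0.
  by move/(parabolic_genP R Gamma_large).
- by exists c; rewrite e Tc.
- have : (f @` parabolic [set a]) (gen c) by rewrite e Tcd; apply: parabolic_gen; left.
  have : (f @` parabolic [set a]) (gen d) by rewrite e Tcd; apply: parabolic_gen; right.
  rewrite parabolic1 => -[x ax xd] [y ay yc].
  have /gen_noncommute[] := cd; rewrite -xd -yc /commute -!automorphism_morph.
  by rewrite (generated1_commute ax ay).
Qed.

Variable s : Gamma -> Gamma.
Hypothesis sP : forall a, f @` parabolic [set a] = parabolic [set s a].

Lemma vertex_map_inj : injective s.
Proof.
move=> a b e; have : parabolic [set a] = parabolic [set b].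
  by apply: automorphism_image_inj; rewrite !sP e.
move=> ab; have : parabolic [set b] (gen a) by rewrite -ab; exact: parabolic_gen.
by move/(parabolic_genP R Gamma_large).
Qed.

(** [f] restricts to an isomorphism between infinite cyclic groups, and an invertible integer is 1
    or -1. *)
Lemma image_gen_sign a : f (gen a) = gen (s a) \/ f (gen a) = (gen (s a))^-1%g.
Proof.
set c := gen (s a); set y := f (gen a).
have : parabolic [set s a] y by rewrite -sP; exists (gen a) => //; exact: parabolic_gen.
rewrite parabolic1 generated1 => -[n _ [m _ ynm]].
have : (f @` parabolic [set a]) c by rewrite sP; exact: parabolic_gen.
rewrite parabolic1 generated1 => -[_ [n' _ [m' _ <-]]].
rewrite automorphism_morph morphV; last exact: automorphism_morph.
rewrite !(morphX _ _ automorphism_morph) -/y => yc.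
have cy : commute c y by rewrite -ynm; exact: commute_divX.
have ycm : (y * c ^+ m = c ^+ n)%g by rewrite -ynm -/c divgK.
have yk k : (y ^+ k * c ^+ (m * k) = c ^+ (n * k))%g.
  by rewrite !expgnA -ycm expgMn //; apply: commuteX; exact/esym.
(* This is [(n - m) (n' - m') = 1] with the negative terms moved over, so that all exponents are
   natural numbers. *)
have key : (c ^+ (1 + n * m' + m * n') = c ^+ (n * n' + m * m'))%g.
  have yn' : (y ^+ n' = c * y ^+ m')%g by rewrite -yc divgK.
  rewrite !expgnDr expg1 -(yk m') -(yk n') yn' -!mulgA.
  by rewrite -!expgnDr addnC.
have E := gen_expg_inj R Gamma_large key.
have : (n = m.+1 \/ m = n.+1)%N.
  have /intUnitRing.unitzPl : (n'%:Z - m'%:Z) * (n%:Z - m%:Z) = 1 by lia.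
  by rewrite qualifE => /orP[]/eqP; lia.
case=> nm; [left|right]; rewrite -ynm nm -/c.
  by rewrite expgS mulgK.
by rewrite expgS invgM mulVKg.
Qed.

(** The image of the edge group is a spherical parabolic subgroup containing the distinct generators
    [gen (s a)] and [gen (s b)], which forces its type to be the edge [{s a, s b}]. *)
Lemma vertex_map_adj a b : adj a b -> adj (s a) (s b).
Proof.
move=> ab; have sph : spherical [set a; b] by apply: Or33; exists a, b.
have [T sT e] := f_parabolic sph.
have inT c : [set a; b] c -> T (s c).
  move=> abc; apply/(parabolic_genP R Gamma_large); rewrite -e.
  have : (f @` parabolic [set c]) (gen (s c)) by rewrite sP; exact: parabolic_gen.
  by move=> [x cx <-]; exists x => //; apply: parabolicS cx => d ->.
have sab : s a <> s b by move=> /vertex_map_inj ba; move: ab; rewrite ba adj_irr.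
have := inT a (or_introl erefl); have := inT b (or_intror erefl).
case: sT => [->[]|[c ->]|[c [d [cd ->]]]].
  by move=> /= bc ac; case: sab; rewrite ac bc.
case=> sb [] sa; rewrite sa sb // ?(adj_sym d) //.
- by case: sab; rewrite sa sb.
- by case: sab; rewrite sa sb.
Qed.

(** Opposite signs at [a] and [b] would turn the braid relation, under [f], into one excluded by
    [alt_prod_mixed_neq]. *)
Lemma sign_adj a b : adj a b -> f (gen a) = gen (s a) -> f (gen b) = gen (s b).
Proof.
move=> ab fa; have [//|fb] := image_gen_sign b.
have := congr1 f (artin_braid ab); rewrite !(alt_prod_morph _ _ _ automorphism_morph) fa fb.
by move/(alt_prod_mixed_neq R Gamma_large (vertex_map_adj ab) (label_gt0 Gamma_large ab)).
Qed.

Lemma sign_const : (forall a, f (gen a) = gen (s a)) \/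
  (forall a, f (gen a) = (gen (s a))^-1%g).
Proof.
pose P := [pred a | `[< f (gen a) = gen (s a) >]].
have Pcl : fingraph.closed adj P.
  move=> a b ab; apply/asboolP/asboolP; apply: sign_adj => //.
  by rewrite adj_sym.
case: (pselect (exists a, f (gen a) = gen (s a))) => [[a fa]|no].
  left=> b; have := closed_connect Pcl (Gamma_connected a b).
  by rewrite !inE => ab; apply/asboolP; rewrite -ab; apply/asboolP.
by right=> a; have [fa|//] := image_gen_sign a; case: no; exists a.
Qed.

Lemma vertex_map_label a b : adj a b -> (forall a, f (gen a) = gen (s a)) ->
  (label (s a) (s b) <= label a b)%N.
Proof.
move=> ab fs; have := congr1 f (artin_braid ab).
rewrite !(alt_prod_morph _ _ _ automorphism_morph) !fs.
exact: (alt_prod_gen_inj R Gamma_large (vertex_map_adj ab) (label_gt0 Gamma_large ab)).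
Qed.

Lemma graph_aut_of_pos : (forall a, f (gen a) = gen (s a)) -> graph_aut f.
Proof.
move=> fs; split=> //; exists (perm vertex_map_inj); last by move=> a; rewrite permE fs.
apply: graph_perm_of_mono => a b ab; rewrite !permE.
by split; [exact: vertex_map_adj|exact: vertex_map_label].
Qed.

End VertexMap.

Lemma inversion_parabolic (iota : artin -> artin) S : global_inversion iota ->
  iota @` parabolic S = parabolic S.
Proof.
have img : forall j : artin -> artin, {morph j : x y / (x * y)%g} ->
    (forall a, j (gen a) = (gen a)^-1%g) ->
    forall x, parabolic S x -> parabolic S (j x).
  move=> j jM jV; apply: (@parabolic_min _ S (j @^-1` parabolic S)) => [|a Sa].
    split=> [|x y Sx Sy] /=; first by rewrite morph1 //; case: (parabolic_subgroup S).
    by rewrite jM morphV //; exact: (proj2 (parabolic_subgroup S) _ _ Sx Sy).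
  by rewrite /= jV; apply: (@subgroupV _ (parabolic S));
    [exact: parabolic_subgroup|exact: parabolic_gen].
case=> -[_ iM] iV; have ii : iota \o iota = id.
  by apply: artin_hom_ext => // [y z|a] /=; rewrite ?iM // iV morphV // iV invgK.
apply/seteqP; split=> x; first by move=> [y Sy <-]; exact: img.
by move=> Sx; exists (iota x); [exact: img|rewrite -[LHS]/((iota \o iota) x) ii].
Qed.

(** If all signs are negative, composing with the global inversion makes them positive. The
    inversion preserves every standard parabolic subgroup, so the analysis of the vertex map applies
    to the composite. *)
Theorem AutGamma_of_parabolic f : automorphism f ->
  (forall S, spherical S -> exists2 T, spherical T & f @` parabolic S = parabolic T) ->
  AutGamma f.
Proof.
move=> fA fP; have [s sP] := rank1_image fA fP.
have [pos|neg] := sign_const fA fP sP.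
  by apply: AutGamma_gen; right; left; exact: graph_aut_of_pos pos.
have [iota [iG iK]] := exists_global_inversion Gamma.
have -> : f = iota \o (iota \o f) by apply/funext => x /=; rewrite iK.
apply: AutGamma_comp; first by apply: AutGamma_gen; right; right.
apply: AutGamma_gen; right; left.
have [[iB iM] iV] := iG.
have ifA : automorphism (iota \o f).
  by case: fA => fB fM; split; [exact: bij_comp|move=> x y /=; rewrite fM iM].
apply: (graph_aut_of_pos ifA _ (s := s)) => [S sS|a|a].
- have [T sT e] := fP S sS; exists T => //.
  by rewrite -image_comp e inversion_parabolic.
- by rewrite -image_comp sP inversion_parabolic.
- by rewrite /= neg morphV // iV invgK.
Qed.

End ParabolicPreserving.

(** * Points of the Deligne complex *)

Lemma chain_min (T : Type) (s : seq (set T)) : s != [::] ->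
  (forall C D, C \in s -> D \in s -> C `<=` D \/ D `<=` C) ->
  exists2 C, C \in s & forall D, D \in s -> C `<=` D.
Proof.
elim: s => [//|A s IH] _ ch; case: (eqVneq s [::]) => [->|s0].
  by exists A; rewrite ?mem_head // => D; rewrite inE => /eqP ->.
have [|C Cs Cmin] := IH s0.
  by move=> C D Cs Ds; apply: ch; rewrite inE ?Cs ?Ds orbT.
have As : A \in A :: s by rewrite mem_head.
have Cs' : C \in A :: s by rewrite inE Cs orbT.
case: (ch A C As Cs') => [AC|CA].
  exists A => // D; rewrite inE => /orP[/eqP ->//|Ds].
  exact: subset_trans AC (Cmin D Ds).
by exists C => // D; rewrite inE => /orP[/eqP ->//|/Cmin].
Qed.

Lemma fsum_seq (R : realType) (I : choiceType) (x : I -> R) (s : seq I) : uniq s ->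
  (forall i, i \notin s -> x i = 0) -> \sum_(i \in [set: I]) x i = \sum_(i <- s) x i.
Proof.
move=> us x0; rewrite [RHS]fsbig_seq //; symmetry; apply: fsbig_widen => // i [_ /=].
by move/negP; exact: x0.
Qed.

Section Simplices.
Variables (R : realType) (Gamma : labelled_graph).
Hypothesis Gamma_large : large_type Gamma.
Implicit Types (a b c d : Gamma) (S T : set Gamma).
Local Notation artin := (artin Gamma).
Local Notation gen := (@artin_gen Gamma).
Implicit Types (g h k : artin) (C D : set artin).
Local Notation deligne := (deligne Gamma R).
Implicit Types (x y z : deligne).

Definition vertex g S : set artin := lcoset g (parabolic S).

Lemma vertex0 g : vertex g set0 = [set g].
Proof. by rewrite /vertex parabolic0 lcoset1. Qed.

Lemma vertex_mem g S : vertex g S g.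
Proof. exact: lcoset_refl (parabolic_subgroup S). Qed.

Lemma vertex_eq g h S : vertex g S h -> vertex g S = vertex h S.
Proof. exact: lcoset_eq (parabolic_subgroup S). Qed.

Lemma vertex_subset g S T : vertex g S `<=` vertex g T <-> S `<=` T.
Proof.
split=> [/lcoset_subset ST a Sa|ST]; last by apply/lcoset_subset; exact: parabolicS.
by move: (ST _ (parabolic_gen Sa)) => /(parabolic_genP R Gamma_large).
Qed.

Lemma vertex_inj g S T : vertex g S = vertex g T -> S = T.
Proof.
move=> e; apply/seteqP.
by split; apply/(vertex_subset g); rewrite e; exact: subset_refl.
Qed.

Lemma vertex_neq1 g h S : S !=set0 -> vertex g S != [set h].
Proof.
move=> [a Sa]; apply/eqP => e; have gh : g = h by have := vertex_mem g S; rewrite e.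
rewrite -gh -vertex0 in e; move: Sa; by rewrite (vertex_inj e).
Qed.

Lemma spherical0 : spherical (set0 : set Gamma).
Proof. exact: Or31. Qed.

Lemma deligne_ext x y : sval x = sval y -> x = y.
Proof. by case: x y => x px [y py] /= e; exact: eq_exist. Qed.

(** The support is a finite chain, and its least coset [g A_S] supplies one representative [g] for
    all cosets in it. Inclusion of cosets then becomes inclusion of types. *)
Lemma min_support x : exists g S, [/\ spherical S, sval x (vertex g S) != 0 &
  forall D, sval x D != 0 -> exists T, [/\ spherical T, S `<=` T & D = vertex g T]].
Proof.
have [_ /finite_seqP[s sE] xV xch x1] := svalP x.
have sP C : (C \in s) = (sval x C != 0).
  have /= e := congr1 (@^~ C) sE.
  by apply/idP/idP => Cs; [rewrite e|rewrite -e].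
have s0 : s != [::].
  apply/eqP => s0; move/eqP: x1; rewrite (@fsum_seq _ _ (sval x) [::]) //.
    by rewrite big_nil eq_sym oner_eq0.
  by move=> C _; apply/eqP; rewrite -[_ == _]negbK -sP s0.
have [C D|C Cs Cmin] := chain_min s0.
  by rewrite !sP; exact: xch.
rewrite sP in Cs; have [g [S [sS Ce]]] := xV C Cs.
exists g, S; split=> // [|D nD]; first by rewrite /vertex -Ce.
have CD : C `<=` D by apply: Cmin; rewrite sP.
have [h [T [sT De]]] := xV D nD.
have Dg : vertex h T g by rewrite /vertex -De; apply: CD; rewrite Ce; exact: vertex_mem.
exists T; split=> //; last by rewrite De; exact: vertex_eq.
by apply/(vertex_subset g); rewrite -(vertex_eq Dg) /vertex -Ce -De.
Qed.

Lemma edge_point C D (t : R) : deligne_vertex C -> deligne_vertex D -> C `<=` D ->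
  C != D -> 0 <= t <= 1 ->
  exists z, sval z = fun E => (1 - t) * (E == C)%:R + t * (E == D)%:R.
Proof.
move=> vC vD CD nCD /andP[t0 t1].
pose f (E : set artin) : R := (1 - t) * (E == C)%:R + t * (E == D)%:R.
have f0 E : E \notin [:: C; D] -> f E = 0.
  by rewrite /f !inE negb_or => /andP[/negbTE -> /negbTE ->]; rewrite !mulr0 addr0.
have fs E : f E != 0 -> E = C \/ E = D.
  move=> nE; have : E \in [:: C; D] by apply: contraNT nE => /f0 ->.
  by rewrite !inE => /orP[] /eqP; [left|right].
have fP : deligne_point f; last by exists (exist _ f fP).
split.
- by move=> E; rewrite /f addr_ge0 // mulr_ge0 // ?subr_ge0 ?ler0n.
- apply: (@sub_finite_set _ _ [set` [:: C; D]]); last exact: finite_seq.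
  by move=> E /= /fs[] ->; rewrite !inE eqxx ?orbT.
- by move=> E /= /fs[] ->.
- by move=> E F /fs[] -> /fs[] ->; [left|left|right|left].
- rewrite (@fsum_seq _ _ f [:: C; D]) //; last by rewrite /= inE nCD.
  rewrite big_cons big_seq1 /f !eqxx (negbTE nCD) (eq_sym D) (negbTE nCD).
  by rewrite /=; ring.
Qed.

Lemma simplex_sum3 g a b x : adj a b ->
  supported x [set vertex g set0; vertex g [set a]; vertex g [set a; b]] ->
  sval x (vertex g set0) + sval x (vertex g [set a]) + sval x (vertex g [set a; b]) = 1.
Proof.
move=> ab sx; have [_ _ _ _ <-] := svalP x.
have aNb : a <> b by move=> e; move: ab; rewrite e adj_irr.
rewrite (@fsum_seq _ _ (sval x)
  [:: vertex g set0; vertex g [set a]; vertex g [set a; b]]).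
- by rewrite !big_cons big_nil addr0 addrA.
- rewrite /= !inE negb_or andbT; apply/andP; split; [apply/andP; split|];
    apply/eqP => /vertex_inj e.
  + by have : [set a] a by []; rewrite -e.
  + by have : [set a; b] a by [left]; rewrite -e.
  + by have : [set a; b] b by [right]; rewrite -e => /esym.
- move=> C nC; apply/eqP; apply: contraNT nC => /sx [[]|] ->;
    by rewrite !in_cons eqxx ?orbT.
Qed.

Lemma simplex_sum2 g a x : supported x [set vertex g set0; vertex g [set a]] ->
  sval x (vertex g set0) + sval x (vertex g [set a]) = 1.
Proof.
move=> sx; have [_ _ _ _ <-] := svalP x.
rewrite (@fsum_seq _ _ (sval x) [:: vertex g set0; vertex g [set a]]).
- by rewrite !big_cons big_nil addr0.
- rewrite /= !inE andbT; apply/eqP => /vertex_inj e.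
  by have : [set a] a by []; rewrite -e.
- move=> C nC; apply/eqP; apply: contraNT nC => /sx [] ->;
    by rewrite !in_cons eqxx ?orbT.
Qed.

Lemma euclidean_dist_ge0 (p q : R * R) : 0 <= euclidean_dist p q.
Proof. exact: sqrtr_ge0. Qed.

Lemma euclidean_distC (p q : R * R) : euclidean_dist p q = euclidean_dist q p.
Proof. by rewrite /euclidean_dist; congr Num.sqrt; ring. Qed.

Lemma euclidean_dist1 (p q : R * R) : `|p.1 - q.1| <= euclidean_dist p q.
Proof. by rewrite -sqrtr_sqr ler_wsqrtr // lerDl sqr_ge0. Qed.

Lemma euclidean_dist2 (p q : R * R) : `|p.2 - q.2| <= euclidean_dist p q.
Proof. by rewrite -sqrtr_sqr ler_wsqrtr // lerDr sqr_ge0. Qed.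

(** The angle is at most [pi / 4], so the side from [p1] to [p2] has length at least 1 and the
    barycentric coordinate at [p2] is 1-Lipschitz. *)
Lemma tan_label (m : nat) : (2 <= m)%N -> 0 < tan (pi / (2 * m)%:R : R) <= 1.
Proof.
move=> m2; have p0 := pi_gt0 R.
have m4 : 4 <= (2 * m)%:R :> R by rewrite ler_nat; lia.
have le4 : pi / (2 * m)%:R <= pi / 4 :> R.
  by rewrite ler_pM2l // lef_pV2 // posrE; lra.
have t0 : 0 < pi / (2 * m)%:R :> R by rewrite divr_gt0 //; lra.
have lt2 : pi / (2 * m)%:R < pi / 2 :> R by apply: le_lt_trans le4 _; lra.
apply/andP; split.
  rewrite /tan divr_gt0 //; first by rewrite sin_gt0_pihalf // t0.
  by rewrite cos_gt0_pihalf //; apply/andP; split=> //; lra.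
rewrite -[leRHS](@tan_piquarter R) leNgt ltr_tan ?in_itv /= -?leNgt //.
  by apply/andP; split; lra.
by apply/andP; split; lra.
Qed.

(** In a triangle the coordinates at [C0] and [C2] are 1-Lipschitz, being bounded by the two
    Euclidean ones; the third is 1 minus their sum, whence the factor 2. Coordinates outside the
    simplex vanish at both points. *)
Lemma coord_simplex x y r C : simplex_dist x y r -> `|sval x C - sval y C| <= 2 * r.
Proof.
case=> [g a b C0 C1 C2 pos ab sx sy|g a C0 C1 sx sy].
  set r0 := euclidean_dist _ _.
  have r0_ge0 : 0 <= r0 by exact: euclidean_dist_ge0.
  have d0 : `|sval x C0 - sval y C0| <= r0.
    have := euclidean_dist1 (pos x) (pos y).
    by rewrite /= !mulr1 !mulr0 !addr0.
  have d2 : `|sval x C2 - sval y C2| <= r0.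
    have := euclidean_dist2 (pos x) (pos y); rewrite -/r0 /= !mulr0 !add0r.
    have /andP[t0 t1] := tan_label (label_ge2 ab).
    rewrite -mulrBl normrM normfV (gtr0_norm t0) ler_pdivrMr //.
    move/le_trans; apply; by rewrite ler_piMr.
  have d1 : `|sval x C1 - sval y C1| <= 2 * r0.
    have := simplex_sum3 ab sx; have := simplex_sum3 ab sy.
    rewrite -/C0 -/C1 -/C2 => ey ex.
    have -> : sval x C1 - sval y C1 =
        - (sval x C0 - sval y C0) - (sval x C2 - sval y C2).
      lra.
    by apply: le_trans (ler_normB _ _) _; rewrite normrN; lra.
  case: (pselect ([set C0; C1; C2] C)) => [[[->|->]|->]|nC]; try lra.
  have x0 : sval x C = 0 by apply/eqP/negPn/negP => /sx.
  have y0 : sval y C = 0 by apply/eqP/negPn/negP => /sy.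
  by rewrite x0 y0 subrr normr0; lra.
have := simplex_sum2 sx; have := simplex_sum2 sy; rewrite -/C0 -/C1 => ey ex.
have n0 := normr_ge0 (sval x C0 - sval y C0).
case: (pselect ([set C0; C1] C)) => [[->|->]|nC]; first by lra.
  have -> : sval x C1 - sval y C1 = - (sval x C0 - sval y C0) by lra.
  by rewrite normrN; lra.
have x0 : sval x C = 0 by apply/eqP/negPn/negP => /sx.
have y0 : sval y C = 0 by apply/eqP/negPn/negP => /sy.
by rewrite x0 y0 subrr normr0; lra.
Qed.

Lemma simplex_dist_ge0 x y r : simplex_dist x y r -> 0 <= r.
Proof. by case=> *; [exact: euclidean_dist_ge0|exact: normr_ge0]. Qed.

Lemma simplex_distC x y r : simplex_dist x y r -> simplex_dist y x r.
Proof.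
case=> [g a b C0 C1 C2 pos ab sx sy|g a C0 C1 sx sy].
  by rewrite euclidean_distC; exact: (TriangleDist ab sy sx).
by rewrite distrC; exact: (EdgeDist sy sx).
Qed.

End Simplices.

(** * The Moussong metric *)

Section Connectivity.
Variables (R : realType) (Gamma : labelled_graph).
Hypothesis Gamma_large : large_type Gamma.
Variable a0 : Gamma.
Implicit Types (a b c d : Gamma) (S T : set Gamma).
Local Notation artin := (artin Gamma).
Local Notation gen := (@artin_gen Gamma).
Implicit Types (g h k : artin) (C D : set artin).
Local Notation deligne := (deligne Gamma R).
Implicit Types (x y z : deligne).

(** Strings between any two points make the set defining [moussong_dist] nonempty, as lower bounds
    on its infimum require. *)
Definition joined x y := exists r, string_length x y r.

Lemma joined_refl x : joined x x.
Proof. by exists 0; exact: string_nil. Qed.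

Lemma joined_simplex x y r : simplex_dist x y r -> joined x y.
Proof. by move=> xy; exists (r + 0); apply: string_cons xy (string_nil _). Qed.

Lemma joined_trans x y z : joined x y -> joined y z -> joined x z.
Proof.
move=> [r xy] yz; elim: xy yz => // {x y r} x u y r s xu _ IH /IH [q uz].
by exists (r + q); apply: string_cons xu uz.
Qed.

Lemma joined_sym x y : joined x y -> joined y x.
Proof.
move=> [r xy]; elim: xy => {x y r} [x|x u y r s xu _ IH]; first exact: joined_refl.
exact: joined_trans IH (joined_simplex (simplex_distC xu)).
Qed.

Lemma adj_neq a b : adj a b -> a <> b.
Proof. by move=> ab e; move: ab; rewrite e adj_irr. Qed.

Lemma edge_set_sub a b c d : adj a b -> adj c d ->
  [set a; b] `<=` [set c; d] -> [set a; b] = [set c; d].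
Proof.
move=> /adj_neq ab /adj_neq cd sub.
have := sub a (or_introl erefl); have := sub b (or_intror erefl).
by case=> bE [] aE; rewrite aE bE in ab *; rewrite // setUC.
Qed.

Lemma simplex_of_point x : exists g,
  (exists a b, adj a b /\
     supported x [set vertex g set0; vertex g [set a]; vertex g [set a; b]]) \/
  (exists a, supported x [set vertex g set0; vertex g [set a]]).
Proof.
have [g [S [_ _ sup]]] := min_support Gamma_large x; exists g.
have cmp T T' : sval x (vertex g T) != 0 -> sval x (vertex g T') != 0 ->
    T `<=` T' \/ T' `<=` T.
  have [_ _ _ ch _] := svalP x => nT nT'.
  by case: (ch _ _ nT nT') => /(vertex_subset R Gamma_large); [left|right].
case: (pselect (exists b c, adj b c /\ sval x (vertex g [set b; c]) != 0)) =>
    [[b0 [c0 [bc0 n0]]]|no2].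
  (* At most one of the rank one cosets [g A_b0] and [g A_c0] lies in the support, so the ends can
     be ordered to put it first. *)
  have [b [c [bc n nc]]] : exists b c, [/\ adj b c, sval x (vertex g [set b; c]) != 0 &
      sval x (vertex g [set c]) = 0].
    case: (eqVneq (sval x (vertex g [set c0])) 0) => [e|nc]; first by exists b0, c0.
    exists c0, b0; split; [by rewrite adj_sym|by rewrite setUC|].
    apply/eqP/negPn/negP => nb; apply: (adj_neq bc0).
    by case: (cmp _ _ nb nc) => sub; [exact: sub|apply/esym; exact: sub].
  left; exists b, c; split=> // D nD; have [T [sT _ De]] := sup D nD.
  rewrite {}De in nD *; have cT := cmp _ _ nD n.
  case: sT => [T0|[d Td]|[d [e [de Tde]]]]; rewrite ?T0 ?Td ?Tde in nD cT *.
  - by left; left.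
  - case: cT => sub; last first.
      case: (adj_neq bc).
      by rewrite (sub b (or_introl erefl)) (sub c (or_intror erefl)).
    have [db|dc] := sub d erefl; first by left; right; rewrite db.
    by move: nD; rewrite dc nc eqxx.
  - right; case: cT => sub; first by rewrite (edge_set_sub de bc sub).
    by rewrite (edge_set_sub bc de sub).
right; case: (pselect (exists b, sval x (vertex g [set b]) != 0)) => [[b nb]|no1].
  exists b => D nD; have [T [sT _ De]] := sup D nD.
  rewrite {}De in nD *; have cT := cmp _ _ nD nb.
  case: sT => [T0|[d Td]|[d [e [de Tde]]]]; rewrite ?T0 ?Td ?Tde in nD cT *.
  - by left.
  - by right; case: cT => sub; [rewrite (sub d erefl)|rewrite (sub b erefl)].
  - by case: no2; exists d, e.
(* Only [g A_0] is left in the support, and [a0] completes it to an edge. *)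
exists a0 => D nD; have [T [sT _ De]] := sup D nD; rewrite {}De in nD *.
case: sT => [->|[d Td]|[d [e [de Tde]]]]; first by left.
- by case: no1; exists d; rewrite -Td.
- by case: no2; exists d, e; rewrite -Tde.
Qed.

Lemma vertex_deligne g S : spherical S -> deligne_vertex (vertex g S).
Proof. by exists g, S. Qed.

Lemma vertex_chain g S : S !=set0 ->
  vertex g set0 `<=` vertex g S /\ vertex g set0 != vertex g S.
Proof.
move=> S0; split; first exact/(vertex_subset R Gamma_large).
by rewrite eq_sym vertex0 (vertex_neq1 R Gamma_large).
Qed.

Lemma segment_point g S (t : R) : spherical S -> S !=set0 -> 0 <= t <= 1 ->
  exists z, sval z = fun C =>
    (1 - t) * (C == vertex g set0)%:R + t * (C == vertex g S)%:R.
Proof.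
move=> sS S0 t01; have [sub neq] := vertex_chain g S0.
by apply: edge_point => //; apply: vertex_deligne => //; exact: spherical0.
Qed.

Lemma vertex_point g S : spherical S ->
  exists z, sval z = fun C => (C == vertex g S)%:R :> R.
Proof.
have s1 : spherical [set a0] by apply: Or32; exists a0.
have n1 : [set a0] !=set0 by exists a0.
case: (pselect (S !=set0)) => [S0 sS|/set0P/negP/negPn/eqP ->].
  have [|z zE] := segment_point g (t := 1) sS S0; first by rewrite ler01 lexx.
  by exists z; rewrite zE; apply/funext => C; rewrite subrr mul0r add0r mul1r.
have [|z zE] := segment_point g (t := 0) s1 n1; first by rewrite ler01 lexx.
by exists z; rewrite zE; apply/funext => C; rewrite subr0 mul0r addr0 mul1r.
Qed.

Lemma vertex_point_supported g S z (s : set (set artin)) :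
  sval z = (fun C => (C == vertex g S)%:R) -> s (vertex g S) -> supported z s.
Proof.
by move=> zE sS C; rewrite zE; case: (eqVneq C (vertex g S)) => [->//|_]; rewrite eqxx.
Qed.

Lemma vertex_gen g a : vertex (g * gen a)%g [set a] = vertex g [set a].
Proof.
apply/esym/vertex_eq; exists (gen a) => //.
exact: parabolic_gen.
Qed.

(** Each point shares a simplex with some vertex [g A_0], and [g A_0] and [g a A_0] are both
    adjacent to [g A_a]; since the [a] generate the group, all these vertices are joined. *)
Lemma joined_all x y : joined x y.
Proof.
have /choice[base baseE] : forall g,
    exists z, sval z = fun C => (C == vertex g set0)%:R :> R.
  by move=> g; apply: vertex_point; exact: spherical0.
have to_base z : exists g, joined z (base g).
  have [g] := simplex_of_point z; case=> [[a [b [ab sz]]]|[a sz]]; exists g.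
    apply: joined_simplex (TriangleDist ab sz _).
    by apply: vertex_point_supported (baseE g) _; left; left.
  apply: joined_simplex (EdgeDist sz _).
  by apply: vertex_point_supported (baseE g) _; left.
have step g a : joined (base g) (base (g * gen a)%g).
  have [|m mE] := @vertex_point g [set a]; first by apply: Or32; exists a.
  apply: (@joined_trans _ m); apply: joined_simplex.
    apply: (@EdgeDist _ _ _ _ g a).
      by apply: vertex_point_supported (baseE g) _; left.
    by apply: vertex_point_supported mE _; right.
  apply: (@EdgeDist _ _ _ _ (g * gen a)%g a).
    by apply: vertex_point_supported mE _; right; rewrite -/(vertex _ _) vertex_gen.
  by apply: vertex_point_supported (baseE _) _; left.
have base_joined h : forall g, joined (base g) (base (g * h)%g).
  elim/artin_ind: h => [g|a h IH g|a h IH g].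
  - by rewrite mulg1; exact: joined_refl.
  - by rewrite mulgA; exact: joined_trans (step g a) (IH _).
  - rewrite mulgA; apply: joined_trans (IH _); apply: joined_sym.
    by have := step (g * (gen a)^-1)%g a; rewrite -mulgA mulVg mulg1.
have [g xg] := to_base x; have [h yh] := to_base y.
apply: joined_trans xg (joined_trans _ (joined_sym yh)).
by have := base_joined (g^-1 * h)%g g; rewrite mulVKg.
Qed.

Local Notation d := (@moussong_dist Gamma R).

Lemma string_length_ge0 x y r : string_length x y r -> 0 <= r.
Proof. by elim=> // {x y r} x u y r s /simplex_dist_ge0 r0 _ s0; exact: addr_ge0. Qed.

Lemma moussong_simplex x y r : simplex_dist x y r -> d x y <= r.
Proof.
move=> xy; apply: ge_inf; first by exists 0 => s /string_length_ge0.
by rewrite -[r]addr0; apply: string_cons xy (string_nil _).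
Qed.

(** A bound valid inside simplices adds up along strings by the triangle inequality and passes to
    the infimum. *)
Lemma lipschitz_moussong (phi : deligne -> R) (K : R) : 0 < K ->
  (forall x y r, simplex_dist x y r -> `|phi x - phi y| <= K * r) ->
  forall x y, `|phi x - phi y| <= K * d x y.
Proof.
move=> K0 phiK x y; rewrite -ler_pdivrMl //; apply: lb_le_inf; first exact: joined_all.
move=> r /= xy; rewrite ler_pdivrMl //.
elim: xy => {x y r} [x|x u y r s xu _ IH]; first by rewrite subrr normr0 mulr0.
rewrite mulrDr; apply: le_trans (lerD (phiK _ _ _ xu) IH).
exact: ler_distD.
Qed.

Lemma coord_moussong C x y : `|sval x C - sval y C| <= 2 * d x y.
Proof.
by apply: (@lipschitz_moussong (fun z => sval z C)) => // u v r; exact: coord_simplex.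
Qed.

End Connectivity.

(** * Stabilizers and open stars *)

Section Stabilizers.
Variables (R : realType) (Gamma : labelled_graph).
Hypothesis Gamma_large : large_type Gamma.
Implicit Types (a b c : Gamma) (S T : set Gamma).
Local Notation artin := (artin Gamma).
Local Notation gen := (@artin_gen Gamma).
Implicit Types (g h k : artin) (C D : set artin).
Local Notation deligne := (deligne Gamma R).
Implicit Types (x y z : deligne).

Lemma preim_vertex g k S :
  (fun h : artin => (g * h)%g) @^-1` vertex k S = vertex (g^-1 * k)%g S.
Proof. exact: preim_lcoset. Qed.

(** If [k] fixes [x], then [k^-1 g A_S] is in the support and so contains [g]. Conversely, an
    element fixing [g A_S] fixes all larger cosets. Thus the stabilizer is [g A_S g^-1]. *)
Lemma stabilizer_support x g S k :
  sval x (vertex g S) != 0 ->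
  (forall D, sval x D != 0 -> exists2 T, S `<=` T & D = vertex g T) ->
  deligne_act k x = x <-> vertex g S (k * g)%g.
Proof.
move=> nS sup; split=> [kx|kgS].
  have /= := congr1 (fun z => sval z (vertex g S)) kx.
  rewrite /translate preim_vertex => e; rewrite -e in nS.
  have [T ST {}e] := sup _ nS; have : vertex (k^-1 * g)%g S g.
    by rewrite e; exact: vertex_mem.
  by move=> /lcosetP; rewrite invgM invgK -mulgA => kg; apply/lcosetP.
have inv D : sval x D != 0 -> (fun h : artin => (k * h)%g) @^-1` D = D.
  move=> /sup[T ST ->]; rewrite preim_vertex; apply: vertex_eq.
  apply/lcosetP; rewrite invgM invgK -mulgA.
  by move: kgS => /lcosetP; exact: parabolicS.
apply: deligne_ext; apply/funext => C; rewrite /= /translate.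
case: (eqVneq (sval x C) 0) => [C0|/inv -> //].
rewrite C0; apply/eqP/negPn/negP => nD; move/eqP: C0; apply/negP.
have := congr1 (fun E : set artin => (fun h : artin => (k^-1 * h)%g) @^-1` E)
  (inv _ nD).
by rewrite preim_mulg mulgV preim_mul1 preim_mulg mulgV preim_mul1 => <-.
Qed.

Lemma star_support x g D : sval x (vertex g set0) != 0 -> sval x D != 0 ->
  exists T, D = vertex g T.
Proof.
have [_ _ xV ch _] := svalP x => ng nD; have [h [T [_ De]]] := xV D nD.
exists T; rewrite De; apply: vertex_eq.
case: (ch _ _ ng nD) => sub.
  by rewrite /vertex -De; apply: sub; exact: vertex_mem.
have Dh : D h by rewrite De; exact: vertex_mem.
by have := sub h Dh; rewrite vertex0 => ->; exact: vertex_mem.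
Qed.

Lemma star_unique x g h : sval x (vertex g set0) != 0 ->
  sval x (vertex h set0) != 0 -> g = h.
Proof.
move=> ng nh; have [T e] := star_support ng nh.
by have := vertex_mem g T; rewrite -e vertex0.
Qed.

Lemma gen_neq1 a : gen a <> 1%g.
Proof.
move=> a1; have : parabolic (set0 : set Gamma) (gen a) by rewrite parabolic0.
by move/(parabolic_genP R Gamma_large).
Qed.

Lemma star_free x g k : sval x (vertex g set0) != 0 -> deligne_act k x = x -> k = 1%g.
Proof.
move=> ng /(stabilizer_support k ng) kg.
have {}kg : vertex g set0 (k * g)%g.
  by apply: kg => D /(star_support ng)[T ->]; exists T => // a [].
by move: kg; rewrite vertex0 -[g in [set g]]mul1g => /mulIg.
Qed.

(** If the least coset of the support were [g A_S] with [a] in [S], the conjugate [g a g^-1] would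
    fix [x]. With [star_free], the points of trivial stabilizer are those in the open stars of the
    vertices [g A_0]. *)
Lemma free_star x : (forall k, deligne_act k x = x -> k = 1%g) ->
  exists g, sval x (vertex g set0) != 0.
Proof.
move=> free; have [g [S [sS nS sup]]] := min_support Gamma_large x; exists g.
case: (pselect (S !=set0)) => [[a Sa]|/set0P/negP/negPn/eqP <- //].
have [] := @gen_neq1 a; have : (g * gen a * g^-1)%g = 1%g.
  apply: free; apply/(stabilizer_support _ nS).
    by move=> D /sup[T [_ ST ->]]; exists T.
  by rewrite divgK; exists (gen a) => //; exact: parabolic_gen.
by move=> e; apply: (mulgI g); rewrite mulg1 -[RHS]mul1g -e divgK.
Qed.

(* Positive on the open star of the vertex [1], negative on the other open stars
   of translates of that vertex, and zero elsewhere. *)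
Definition signed_height x : R :=
  if sval x (vertex 1%g set0) != 0 then sval x (vertex 1%g set0)
  else - sval x (vertex (xget 1%g [set h | sval x (vertex h set0) != 0]) set0).

Lemma coord_ge0 x C : 0 <= sval x C.
Proof. by case: (svalP x). Qed.

Lemma signed_heightE x g : (forall h, sval x (vertex h set0) != 0 -> h = g) ->
  signed_height x = (if g == 1%g then 1 else -1) * sval x (vertex g set0).
Proof.
move=> uniq; rewrite /signed_height; set h := xget _ _.
(* [xget] falls back on 1 when no vertex [h A_0] is in the support; all these coordinates are then
   0, so the value is the same. *)
have hE : sval x (vertex h set0) = sval x (vertex g set0).
  case: (eqVneq (sval x (vertex g set0)) 0) => [g0|ng].
    by rewrite g0; apply/eqP/negPn/negP => nh; move: (nh); rewrite (uniq _ nh) g0 eqxx.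
  have : sval x (vertex h set0) != 0.
    by apply: (@xgetPex _ 1%g [set h | sval x (vertex h set0) != 0]); exists g.
  by move=> /uniq ->.
case: (eqVneq g 1%g) => [g1|ng1].
  rewrite hE g1 mul1r; case: eqVneq => [->|//]; by rewrite oppr0.
case: (eqVneq (sval x (vertex 1%g set0)) 0) => [_|n1]; first by rewrite hE mulN1r.
by move: ng1; rewrite -(uniq _ n1) eqxx.
Qed.

Lemma signed_height_neq0 x g : sval x (vertex g set0) != 0 -> signed_height x != 0.
Proof.
move=> ng; rewrite (@signed_heightE x g) => [|h nh]; last exact: star_unique ng.
by rewrite mulf_neq0 //; case: ifP => _; rewrite ?oppr_eq0 oner_neq0.
Qed.

Lemma signed_height_gt0 x : 0 < signed_height x <-> sval x (vertex 1%g set0) != 0.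
Proof.
rewrite /signed_height; case: ifP => [n1|_]; split=> //.
  by move=> _; rewrite lt_def n1 coord_ge0.
by rewrite ltNge oppr_le0 coord_ge0.
Qed.

(** A simplex has only one vertex of the form [g A_0], so on it the signed height is a fixed sign
    times one barycentric coordinate. *)
Lemma signed_height_simplex x y r :
  simplex_dist x y r -> `|signed_height x - signed_height y| <= 2 * r.
Proof.
move=> xy; suff [g [xg yg]] : exists g,
    (forall h, sval x (vertex h set0) != 0 -> h = g) /\
    (forall h, sval y (vertex h set0) != 0 -> h = g).
  rewrite (signed_heightE xg) (signed_heightE yg) -mulrBr normrM.
  have -> : `|if g == 1%g then 1 else -1| = 1 :> R.
    by case: ifP => _; rewrite ?normrN normr1.
  by rewrite mul1r; exact: (coord_simplex Gamma_large).
have sing g h : vertex h set0 = vertex g set0 -> h = g.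
  by rewrite !vertex0 => e; have : [set h] h by []; rewrite e.
have nsing g h S : S !=set0 -> vertex h set0 <> vertex g S.
  by rewrite vertex0 => S0 /esym/eqP; apply/negP; exact: (vertex_neq1 R Gamma_large).
case: xy => [g a b C0 C1 C2 pos ab sx sy|g a C0 C1 sx sy]; exists g.
  by split=> h; [move=> /sx|move=> /sy] => -[[/sing//|/nsing[]]|/nsing[]];
    exists a => //; left.
by split=> h; [move=> /sx|move=> /sy] => -[/sing//|/nsing[]]; exists a.
Qed.

End Stabilizers.

(** * Isometries compatible with an automorphism *)

Lemma lipschitz_on_IVT (R : realType) (phi : R -> R) (K a b : R) : a <= b ->
  (forall s t, a <= s <= b -> a <= t <= b -> `|phi s - phi t| <= K * `|s - t|) ->
  0 < phi a -> (forall t, a <= t <= b -> phi t != 0) -> 0 < phi b.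
Proof.
move=> ab phiK pa nz; rewrite ltNge; apply/negP => pb.
have [||c] := @IVT R phi a b 0 ab.
- apply/subspace_continuousP => x xab; apply/cvgrPdist_lt => e e0.
  (* [K] carries no sign, so [|K| + 1] serves as a positive Lipschitz constant. *)
  have L0 : 0 < `|K| + 1 by rewrite ltr_wpDl.
  rewrite near_withinE; apply/nbhs_ballP; exists (e / (`|K| + 1)).
    by rewrite /= divr_gt0.
  move=> t; rewrite /ball /= => xt tab.
  rewrite !in_itv /= in xab tab.
  apply: le_lt_trans (phiK _ _ xab tab) _; rewrite ltr_pdivlMr // in xt.
  apply: le_lt_trans xt; rewrite mulrC ler_wpM2l //.
  by apply: le_trans (ler_norm K) _; rewrite lerDl.
- by rewrite ge_min le_max pb (ltW pa) orbT.
by rewrite in_itv /= => /nz /eqP.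
Qed.

Section Isometries.
Variables (R : realType) (Gamma : labelled_graph).
Hypothesis Gamma_large : large_type Gamma.
Variable a0 : Gamma.
Implicit Types (a b c : Gamma) (S T : set Gamma).
Local Notation artin := (artin Gamma).
Local Notation gen := (@artin_gen Gamma).
Implicit Types (g h k : artin) (C D : set artin).
Local Notation deligne := (deligne Gamma R).
Implicit Types (x y z : deligne).
Local Notation d := (@moussong_dist Gamma R).

(** The segment lies in one simplex and is run at constant speed. [L] is its length: 1 in rank one,
    and the hypotenuse [sqrt (1 + cot^2)] for an edge. *)
Lemma segment_lipschitz S (z : R -> deligne) : spherical S -> S !=set0 ->
  (forall t, 0 <= t <= 1 -> sval (z t) = fun C =>
    (1 - t) * (C == vertex 1%g set0)%:R + t * (C == vertex 1%g S)%:R) ->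
  exists2 L, 0 < L & forall s t, 0 <= s <= 1 -> 0 <= t <= 1 ->
    d (z s) (z t) <= L * `|s - t|.
Proof.
move=> sS S0 zE; have [_ neq] := vertex_chain R Gamma_large 1%g S0.
have z0 t : 0 <= t <= 1 -> sval (z t) (vertex 1%g set0) = 1 - t.
  by move=> /zE ->; rewrite eqxx (negbTE neq) /= mulr1 mulr0 addr0.
have z1 t : 0 <= t <= 1 -> sval (z t) (vertex 1%g S) = t.
  by move=> /zE ->; rewrite eqxx eq_sym (negbTE neq) /= mulr1 mulr0 add0r.
have zs t C : 0 <= t <= 1 -> sval (z t) C != 0 ->
    C = vertex 1%g set0 \/ C = vertex 1%g S.
  move=> /zE -> /=; case: (eqVneq C (vertex 1%g set0)) => [->|_]; first by left.
  by case: (eqVneq C (vertex 1%g S)) => [->|_]; [right|rewrite !mulr0 addr0 eqxx].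
case: sS => [e|[a Sa]|[a [b [ab Sab]]]]; first by case: S0; rewrite e => ? [].
  exists 1 => // s t s01 t01; rewrite mul1r.
  have -> : `|s - t| = `|sval (z s) (vertex 1%g set0) - sval (z t) (vertex 1%g set0)|.
    by rewrite !z0 // distrC; congr `|_|; ring.
  apply/moussong_simplex/(@EdgeDist _ _ _ _ 1%g a) => C /zs;
    by rewrite Sa => -[]// ->; [left|right].
set cot := (tan (pi / (2 * label a b)%:R) : R)^-1.
have L0 : 0 < 1 + cot ^+ 2 by rewrite ltr_pwDl // sqr_ge0.
exists (Num.sqrt (1 + cot ^+ 2)) => [|s t s01 t01]; first by rewrite sqrtr_gt0.
pose pos u := triangle_point (label a b) (sval (z u) (vertex 1%g set0))
  (sval (z u) (vertex 1%g [set a])) (sval (z u) (vertex 1%g [set a; b])).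
have <- : euclidean_dist (pos s) (pos t) = Num.sqrt (1 + cot ^+ 2) * `|s - t|.
  rewrite -sqrtr_sqr -sqrtrM ?(ltW L0) // /euclidean_dist /pos /triangle_point /= -/cot.
  by rewrite -Sab !z0 // !z1 //; congr Num.sqrt; ring.
apply/moussong_simplex/(@TriangleDist _ _ _ _ 1%g a b) => // C /zs;
  rewrite Sab => -[]// ->.
- by left; left.
- by right.
- by left; left.
- by right.
Qed.

Variables (f : artin -> artin) (F : deligne -> deligne).
Hypothesis f_aut : automorphism f.
Hypothesis F_isometry : Defs.isometry d F.
Hypothesis F_equiv : forall k x, F (deligne_act k x) = deligne_act (f k) (F x).

Lemma stabilizer_image k x : deligne_act (f k) (F x) = F x <-> deligne_act k x = x.
Proof.
by rewrite -F_equiv; split=> [/(bij_inj (proj1 F_isometry))|->].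
Qed.

(** Equivariance makes the stabilizer of [F x] the image under [f] of that of [x], so trivial
    stabilizers stay trivial. *)
Lemma free_image x : (forall k, deligne_act k x = x -> k = 1%g) ->
  exists g, sval (F x) (vertex g set0) != 0.
Proof.
move=> free; apply: (free_star Gamma_large) => k.
have [[f' fK f'K] fM] := f_aut; rewrite -(f'K k) => /stabilizer_image/free ->.
exact: morph1.
Qed.

Lemma coord_image C x y : `|sval (F x) C - sval (F y) C| <= 2 * d x y.
Proof. by rewrite -(proj2 F_isometry); exact: (coord_moussong Gamma_large a0). Qed.

Variable x0 : deligne.
Hypothesis x0E : sval x0 = fun C => (C == vertex 1%g set0)%:R.
Hypothesis Fx0 : sval (F x0) (vertex 1%g set0) != 0.

(** Before its end [z 1], the segment from [A_0] to [A_S] consists of points with trivial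
    stabilizer, so its image stays in the open star of the vertex 1 where it starts. Hence every
    coset in the support of [F (z 1)] contains 1, and the stabilizer of [F (z 1)], which is
    [f (A_S)], is a standard parabolic subgroup [A_T]. *)
Lemma parabolic_image S : spherical S ->
  exists2 T, spherical T & f @` parabolic S = parabolic T.
Proof.
move=> sS; have [f_bij fM] := f_aut.
case: (pselect (S !=set0)) => [S0|/set0P/negP/negPn/eqP ->]; last first.
  by exists set0; rewrite ?parabolic0 ?image_set1 ?morph1 //; exact: spherical0.
have /choice[z zE] : forall t : R, exists z : deligne, 0 <= t <= 1 -> sval z = fun C =>
    (1 - t) * (C == vertex 1%g set0)%:R + t * (C == vertex 1%g S)%:R.
  move=> t; case: (pselect (0 <= t <= 1)) => [t01|nt]; last by exists x0.
  by have [z zE] := segment_point Gamma_large 1%g sS S0 t01; exists z.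
have [L L0 zL] := segment_lipschitz sS S0 zE.
have [_ neq] := vertex_chain R Gamma_large 1%g S0.
have I01 : 0 <= (1 : R) <= 1 by rewrite ler01 lexx.
(* Along the segment the signed height of the image is Lipschitz and never zero, so it keeps the
   positive sign that it has at [x0]. *)
have star t : 0 <= t -> t < 1 -> sval (F (z t)) (vertex 1%g set0) != 0.
  move=> t0 t1; apply/(signed_height_gt0 _).
  apply: (@lipschitz_on_IVT R (fun u => signed_height (F (z u))) (2 * L) 0 t) => //.
  - move=> u v /andP[u0 ut] /andP[v0 vt].
    have h2 := lipschitz_moussong Gamma_large a0 (ltr0n R 2)
      (signed_height_simplex Gamma_large).
    have u01 : 0 <= u <= 1 by rewrite u0 (le_trans ut (ltW t1)).
    have v01 : 0 <= v <= 1 by rewrite v0 (le_trans vt (ltW t1)).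
    apply: le_trans (h2 _ _) _; rewrite (proj2 F_isometry) -mulrA.
    by rewrite ler_pM2l // zL.
  - have -> : z 0 = x0.
      apply: deligne_ext; rewrite x0E zE ?lexx ?ler01 //.
      by apply/funext => C; rewrite subr0 mul1r mul0r addr0.
    exact/signed_height_gt0.
  - move=> u /andP[u0 ut]; have [|g ng] := free_image (x := z u); last first.
      exact: signed_height_neq0 ng.
    have nz : sval (z u) (vertex 1%g set0) != 0.
      rewrite zE ?u0 ?(le_trans ut (ltW t1)) // eqxx (negbTE neq) /= mulr1 mulr0 addr0.
      by rewrite subr_eq0; apply/eqP; lra.
    by move=> k; exact: star_free nz.
set y := F (z 1).
have y1 C : sval y C != 0 -> C 1%g.
  move=> nC; apply: contrapT => C1.
  have y0 : 0 < sval y C by rewrite lt_def nC coord_ge0.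
  (* Moving back from 1 by [e] changes the coordinate at [C] by at most [2 L e], at most half of its
     value at [y], so [C] is also in the support of a point of the star of 1. *)
  pose e := Num.min 1 (sval y C / (4 * L)).
  have e0 : 0 < e by rewrite lt_min ltr01 divr_gt0 // mulr_gt0.
  have e1 : e <= 1 by rewrite ge_min lexx.
  have eL : 4 * L * e <= sval y C.
    by rewrite mulrC -ler_pdivlMr ?mulr_gt0 // ge_min lexx orbT.
  have t01 : 0 <= 1 - e <= 1 by lra.
  have close : `|sval (F (z (1 - e))) C - sval y C| <= 2 * (L * e).
    apply: le_trans (coord_image _ _ _) _; rewrite ler_pM2l //.
    apply: le_trans (zL _ _ t01 I01) _.
    by rewrite addrAC subrr add0r normrN gtr0_norm.
  have nC' : sval (F (z (1 - e))) C != 0.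
    by apply: contraTneq close => ->; rewrite sub0r normrN gtr0_norm // -ltNge; lra.
  have [||T CT] := star_support (star (1 - e) _ _) nC'; try lra.
  by apply: C1; rewrite CT; exact: vertex_mem.
have [g [T [sT nT sup]]] := min_support Gamma_large y.
have gT D : sval y D != 0 -> exists2 T', T `<=` T' & D = vertex 1%g T'.
  move=> nD; have [T' [_ TT' De]] := sup D nD; exists T' => //; rewrite De.
  by apply: vertex_eq; rewrite -De; exact: y1.
have gT1 : vertex g T = vertex 1%g T by apply: vertex_eq; exact: y1.
rewrite gT1 in nT.
have stab_y k : deligne_act k y = y <-> parabolic T k.
  rewrite (stabilizer_support k nT gT) mulg1.
  by split=> [/lcosetP|Tk]; [|apply/lcosetP]; rewrite invg1 mul1g.
have nS : sval (z 1) (vertex 1%g S) != 0.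
  by rewrite zE // eqxx subrr mul0r add0r mul1r oner_neq0.
have gS D : sval (z 1) D != 0 -> exists2 T', S `<=` T' & D = vertex 1%g T'.
  rewrite zE // subrr mul0r add0r mul1r.
  case: (eqVneq D (vertex 1%g S)) => [->|]; last by rewrite eqxx.
  by exists S.
have stab_z k : deligne_act k (z 1) = z 1 <-> parabolic S k.
  rewrite (stabilizer_support k nS gS) mulg1.
  by split=> [/lcosetP|Tk]; [|apply/lcosetP]; rewrite invg1 mul1g.
exists T => //; apply/seteqP; split=> [_ [k Sk <-]|k Tk].
  by apply/stab_y/stabilizer_image/stab_z.
have [f' fK f'K] := f_bij; exists (f' k); rewrite ?f'K //.
by apply/stab_z/stabilizer_image; rewrite f'K; apply/stab_y.
Qed.

End Isometries.

(** * From a compatible action to [AutGamma] *)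

Theorem theorem1p6 (R : realType) (Gamma : labelled_graph)
    (Gamma_connected : connected_graph Gamma)
    (Gamma_large : large_type Gamma)
    (A : set (artin Gamma -> artin Gamma))
    (A_subgroup : aut_subgroup A)
    (A_compatible : compatible_action (@moussong_dist Gamma R)
                      (@deligne_act Gamma R) A) :
  A `<=` AutGamma (Gamma := Gamma).
Proof.
move=> f Af; have [innA [Psi [Psi_iso PsiM PsiI]]] := A_compatible.
have [A_aut _ AM _] := A_subgroup; have Ainn k : A (inner k) by apply: innA; exists k.
(* Without vertices the only spherical type is the empty one; otherwise [a0] makes [joined_all]
   available. *)
case: (pselect (exists a0 : Gamma, True)) => [[a0 _]|no]; last first.
  apply: (AutGamma_of_parabolic R Gamma_connected Gamma_large (A_aut f Af)) => S.
  have fM : {morph f : x y / (x * y)%g} by case: (A_aut f Af).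
  case=> [->|[a _]|[a _]]; [|by case: no; exists a|by case: no; exists a].
  by exists set0; rewrite ?parabolic0 ?image_set1 ?morph1 //; exact: spherical0.
(* [Psi] is applied to the identity [h \o inner k = inner (h k) \o h]. *)
have Psi_equiv h : A h -> forall k (x : deligne Gamma R),
    Psi h (deligne_act k x) = deligne_act (h k) (Psi h x).
  move=> Ah k x; have [_ hM] := A_aut h Ah.
  have e : h \o inner k = inner (h k) \o h.
    by apply/funext => y; rewrite /= /inner !hM (morphV k hM).
  by have := congr1 Psi e; rewrite (PsiM h _ Ah (Ainn k)) (PsiM _ h (Ainn _) Ah) !PsiI
    => /(congr1 (@^~ x)).
have [x0 x0E] := vertex_point R Gamma_large a0 1%g (spherical0 Gamma).
have x0_star : sval x0 (vertex 1%g set0) != 0 by rewrite x0E eqxx oner_neq0.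
have [k nk] := free_image Gamma_large (A_aut f Af) (Psi_iso f Af) (Psi_equiv f Af)
  (fun k => star_free x0_star).
(* [Psi f] maps the base point [x0] into the star of [k]; composing with conjugation by [k^-1] moves
   its image into the star of 1, as [parabolic_image] assumes. *)
pose f1 := inner k^-1%g \o f; have Af1 : A f1 by exact: AM.
have -> : f = inner k \o f1.
  by apply/funext => x; rewrite /f1 /inner /= invgK !mulgA mulgV mul1g mulgK.
apply: AutGamma_comp; first by apply: AutGamma_gen; left; exists k.
apply: (AutGamma_of_parabolic R Gamma_connected Gamma_large (A_aut f1 Af1)).
apply: (parabolic_image Gamma_large a0 (A_aut f1 Af1) (Psi_iso f1 Af1)
  (Psi_equiv f1 Af1) x0E).
rewrite (PsiM _ f (Ainn _) Af) PsiI /= /translate preim_vertex invgK mulg1.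
exact: nk.
Qed.
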